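(* Let $A$ be a unital commutative $\mathbb R$-algebra with $X(A)\neq\varnothing$, let $(b_a)_{a\in A}$ be a family of positive real numbers, and let $L:A\to\mathbb R$ be a linear functional with $L(1)=1$. The following conditions are equivalent: (i) for every $a\in A$ there is a positive Radon measure $\mu_a$ on $[-b_a,b_a]$ such that $$L(a^n)=\int_{[-b_a,b_a]}x^n\,d\mu_a(x)\quad\text{for all } n\in\mathbb N_0;$$ (ii) $L$ is positive semidefinite and $$\sup_{n\in\mathbb N_0,\ L(a^{2n})\ne 0}\frac{L(a^{2n+2})}{L(a^{2n})}\le b_a^2\quad\text{for all } a\in A;$$ (iii) there is a unique positive Radon measure $\mu$ on the compact set $$K=\{\alpha\in X(A):|\alpha(a)|\le b_a\text{ for all }a\in A\}$$ such that $$L(a)=\int_K\alpha(a)\,d\mu(\alpha)\quad\text{for all } a\in A.$$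
   Context: $\mathbb N_0=\{0,1,2,\dots\}$. For a unital commutative $\mathbb R$-algebra $A$, $X(A)$ denotes the set of all (unital) $\mathbb R$-algebra homomorphisms $A\to\mathbb R$, endowed with the topology of pointwise convergence. A linear functional $L:A\to\mathbb R$ is positive semidefinite if $L(a^2)\ge 0$ for all $a\in A$. Convention: $a^0=1$. *)

(* Defs.v *)
From HB Require Import structures.
From mathcomp Require Import all_boot all_order all_algebra.
From mathcomp Require Import all_classical all_reals all_analysis.
Import Order.TTheory GRing.Theory Num.Theory.
Import numFieldNormedType.Exports.

Set Implicit Arguments.
Unset Strict Implicit.
Unset Printing Implicit Defensive.

Local Open Scope classical_set_scope.
Local Open Scope ring_scope.

HB.instance Definition _ (U : Type) (T : U -> ptopologicalType) :=
  Pointed.copy (prod_topology T) (forall x : U, T x).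

Notation borelType T := (g_sigma_algebraType (@open T)).

(* For a closed subset K of a Hausdorff space T, the Borel sets of K are the
   traces on K of those of T, and Borel measures on K are identified with Borel
   measures on T that vanish off K. (A measurableType is a pointed type, whereas
   K is allowed to be empty.) On K, a Radon measure is a locally finite Borel
   measure that is inner regular with respect to the compact subsets of K. *)
Definition radon_on (R : realType) (T : ptopologicalType) (K : set T)
    (mu : {measure set (borelType T) -> \bar R}) : Prop :=
  [/\ mu (~` K) = 0%E,
      forall x, K x -> exists U : set T, [/\ open U, U x & (mu U < +oo)%E]
    & forall B : set (borelType T), measurable B ->
        mu B = ereal_sup [set mu C | C in
                 [set C : set T | compact C /\ C `<=` K `&` B]]].

Definition characters (R : realType) (A : comAlgType R) : set {ptws A -> R} :=
  [set alpha | exists f : {lrmorphism A -> R | *%R}, alpha = f :> (A -> R)].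
Arguments characters {R} A _.

Definition bounded_characters (R : realType) (A : comAlgType R) (b : A -> R) :
    set {ptws A -> R} :=
  [set alpha | characters A alpha /\ forall a, `|alpha a| <= b a].

Definition psd (R : realType) (A : comAlgType R) (L : {scalar A}) : Prop :=
  forall a, 0 <= L (a ^+ 2).

Lemma charactersP (R : realType) (A : comAlgType R) (alpha : {ptws A -> R}) :
  characters A alpha <->
  [/\ alpha 1 = 1, forall x y, alpha (x * y) = alpha x * alpha y &
      forall k x y, alpha (k *: x + y) = k * alpha x + alpha y].
Proof.
split=> [[f ->]|[a1 aM aL]].
  by split=> [|x y|k x y]; rewrite ?rmorph1 ?rmorphM ?linearP.
pose f : A -> R := alpha.
have fB : zmod_morphism f.
  move=> x y; have := aL (-1) y x.
  by rewrite scaleN1r mulN1r [X in alpha X]addrC [RHS]addrC.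
have fZ : scalable_for *%R f.
  have f0 : f 0 = 0 by rewrite -(subrr (0 : A)) fB subrr.
  move=> k x; have := aL k x 0; rewrite addr0.
  by move=> aE; rewrite [LHS]aE [alpha 0]f0 addr0.
have fM : monoid_morphism f by split.
pose m1 := GRing.isZmodMorphism.Build _ _ f fB.
pose m2 := GRing.isMonoidMorphism.Build _ _ f fM.
pose m3 := GRing.isScalable.Build _ _ _ _ f fZ.
pose F : {lrmorphism A -> R | *%R} := HB.pack f m1 m2 m3.
by exists F.
Qed.

Lemma closed_eq_fun (T : topologicalType) (R : realType) (f g : T -> R) :
  continuous f -> continuous g -> closed [set x | f x = g x].
Proof.
move=> cf cg.
rewrite (_ : [set _ | _] = (fun x => f x - g x) @^-1` [set 0]).
  apply: preimage_closed; last exact: closed_eq.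
  by move=> x _; apply: cvgB; [exact: cf|exact: cg].
by apply/seteqP; split=> x /=; [move=> ->; rewrite subrr|move/subr0_eq].
Qed.

Lemma closed_eq_mul (T : topologicalType) (R : realType) (f g h : T -> R) :
  continuous f -> continuous g -> continuous h ->
  closed [set x | f x = g x * h x].
Proof.
move=> cf cg ch; apply: closed_eq_fun => // x.
by apply: cvgM; [exact: cg|exact: ch].
Qed.

Lemma closed_eq_lin (T : topologicalType) (R : realType) (k : R)
    (f g h : T -> R) : continuous f -> continuous g -> continuous h ->
  closed [set x | f x = k * g x + h x].
Proof.
move=> cf cg ch; apply: closed_eq_fun => // x.
by apply: cvgD; [apply: cvgM; [exact: cvg_cst|exact: cg]|exact: ch].
Qed.

Lemma bounded_characters_compact (R : realType) (A : comAlgType R)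
    (b : A -> R) : compact (bounded_characters b).
Proof.
have ev (a : A) : continuous (fun f : {ptws A -> R} => f a : R).
  exact: (@proj_continuous A (fun _ => R) a).
have cbox : compact [set f : {ptws A -> R} | forall a,
    (`[- b a, b a]%classic : set R) (f a)].
  exact: (@tychonoff A (fun _ => R) _ (fun a => @segment_compact R _ _)).
pose E1 : set {ptws A -> R} := [set f | (f 1 : R) = 1].
pose EM (p : A * A) : set {ptws A -> R} :=
  [set f | (f (p.1 * p.2) : R) = (f p.1 : R) * (f p.2 : R)].
pose EL (p : R * A * A) : set {ptws A -> R} :=
  [set f | (f (p.1.1 *: p.1.2 + p.2) : R) = p.1.1 * (f p.1.2 : R) + (f p.2 : R)].
have cE1 : closed E1.
  apply: (@closed_eq_fun _ R (fun f : {ptws A -> R} => f 1 : R) (fun=> 1)).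
    exact: ev.
  exact: cst_continuous.
have cEM p : closed (EM p) := closed_eq_mul (ev _) (ev p.1) (ev p.2).
have cEL p : closed (EL p) :=
  closed_eq_lin (k := p.1.1) (ev _) (ev p.1.2) (ev p.2).
rewrite (_ : bounded_characters b =
    [set f : {ptws A -> R} | forall a,
      (`[- b a, b a]%classic : set R) (f a)] `&`
    (E1 `&` (\bigcap_p EM p `&` \bigcap_p EL p))).
  apply: compact_closedI => //; apply: closedI => //.
  by apply: closedI; apply: closed_bigI.
apply/seteqP; split=> f.
  move=> [/charactersP[f1 fM fL] fb]; split=> [a|] /=.
    by rewrite in_itv/= -ler_norml.
  split; first exact: f1.
  by split=> p _; [exact: fM|exact: fL].
move=> [fb [f1 [fM fL]]]; split.
  apply/charactersP; split=> [|x y|k x y].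
  - exact: f1.
  - exact: (fM (x, y)).
  - exact: (fL (k, x, y)).
by move=> a; have := fb a; rewrite /= in_itv/= -ler_norml.
Qed.

(* Main.v *)
(* By the Cauchy-Schwarz inequality the ratio condition (ii) amounts to
   [L (a ^+ (2 * n)) <= b a ^+ (2 * n)] for all [a] and [n]. The normalized psd
   functionals with this bound, the states, form a compact convex set. An extreme
   state is multiplicative, because it splits along [x |-> (M + c) * x] and
   [x |-> (M - c) * x], so minimizing evaluation at [a] over the states shows that
   [L a >= 0] as soon as [alpha a >= 0] for every character [alpha] in [K].

   A positive functional of this kind is represented as in the Riesz-Markov
   theorem, but with [A] in place of the continuous functions: the measure of an
   open set [U] is the supremum of [L a] over the [a] lying below the indicator of
   [U] on [K]. Finite subadditivity needs elements of [A] that almost separate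
   disjoint compact sets, which the polynomials of Brosowski and Deutsch provide.
   A layer-cake estimate gives [L a <= \int a] for all [a] with values in [0, 1],
   and replacing [a] by [1 - a] turns it into an equality. For another representing
   Radon measure [nu], majorants of compact sets give [nu <= mu], hence equality
   by passing to complements. The measures in (i) are the images of [mu] under the
   evaluations. *)

Require Import Defs.
From HB Require Import structures.
From mathcomp Require Import all_boot all_order all_algebra finmap.
From mathcomp Require Import all_classical all_reals all_analysis.
From mathcomp Require Import measurable_realfun ring lra.
Import Order.TTheory GRing.Theory Num.Theory.
Import numFieldNormedType.Exports.

Set Implicit Arguments.
Unset Strict Implicit.
Unset Printing Implicit Defensive.

Local Open Scope classical_set_scope.
Local Open Scope ring_scope.

(** * Positive semidefinite functionals *)

Lemma bernoulli_ineq (R : realDomainType) (x : R) n :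
  -1 <= x -> 1 + x *+ n <= (1 + x) ^+ n.
Proof.
move=> x1; elim: n => [|n ih]; first by rewrite mulr0n addr0 expr0.
rewrite exprS; apply: (@le_trans _ _ ((1 + x) * (1 + x *+ n))); last first.
  by apply: ler_wpM2l => //; lra.
rewrite mulrS -mulr_natl; have : 0 <= (n%:R : R) by []; nra.
Qed.

(** Log-convexity makes the ratios [u k.+1 / u k] nondecreasing. If the first ratio [r] exceeded
    [q], then [u k] would be at least [r ^+ k * u 0], and its square would outgrow
    [D * q ^+ (2 * k)]. *)
Lemma logconvex_le (R : realType) (u : nat -> R) (D q : R) : 0 < q ->
  (forall k, 0 <= u k) -> (forall k, u k.+1 ^+ 2 <= u k * u k.+2) ->
  (forall k, u k ^+ 2 <= D * q ^+ (2 * k)) ->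
  u 1%N <= q * u 0%N.
Proof.
move=> q0 u0 uC uD; rewrite leNgt; apply/negP => u01.
have u0_gt0 : 0 < u 0%N.
  rewrite lt_neqAle u0 andbT eq_sym; apply/eqP => u0E.
  by have := uC 0%N; rewrite u0E mul0r; move: u01; rewrite u0E mulr0; nra.
pose r := u 1%N / u 0%N.
have qr : q < r by rewrite ltr_pdivlMr.
have r0 : 0 < r by exact: lt_trans qr.
have ur k : 0 < u k /\ r * u k <= u k.+1.
  elim: k => [|k [uk ruk]]; first by rewrite u0_gt0 divfK// gt_eqF.
  have uk1 : 0 < u k.+1 by apply: lt_le_trans ruk; exact: mulr_gt0.
  split=> //; rewrite -(ler_pM2l uk); apply: le_trans (uC k).
  by rewrite expr2 mulrCA mulrA ler_pM2r.
have uge k : r ^+ k * u 0%N <= u k.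
  elim: k => [|k ih]; first by rewrite expr0 mul1r.
  rewrite exprS -mulrA; apply: le_trans (ur k).2.
  by rewrite ler_pM2l.
pose x := (r / q) ^+ 2 - 1.
have x0 : 0 < x.
  have : 1 < r / q by rewrite ltr_pdivlMr// mul1r.
  by rewrite /x subr_gt0 => ?; rewrite exprn_egt1.
have bnd k : 1 + x *+ k <= D / u 0%N ^+ 2.
  rewrite ler_pdivlMr ?exprn_gt0//.
  apply: (@le_trans _ _ ((r / q) ^+ 2 ^+ k * u 0%N ^+ 2)).
    rewrite ler_wpM2r ?sqr_ge0//.
    apply: le_trans (bernoulli_ineq _ _) _; first by lra.
    by rewrite /x addrCA subrr addr0.
  rewrite -exprM expr_div_n mulrAC ler_pdivrMr ?exprn_gt0//.
  apply: le_trans (uD k); rewrite mulnC exprM -exprMn lerXn2r ?nnegrE//.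
  by rewrite mulr_ge0 ?exprn_ge0// ltW.
pose y := D / u 0%N ^+ 2 / x.
have y0 : 0 <= y.
  by rewrite divr_ge0 ?(ltW x0)//; apply: le_trans (bnd 0%N); rewrite mulr0n; lra.
have := archi_boundP y0; rewrite ltr_pdivrMr// mulr_natl => h.
by have := bnd (Num.bound y); lra.
Qed.

Section psd_functionals.
Variables (R : realType) (A : comAlgType R).
Implicit Types (L : {scalar A}) (a s : A).

Lemma psd_cauchy_schwarz L s a : psd L ->
  L (s * a) ^+ 2 <= L (s ^+ 2) * L (a ^+ 2).
Proof.
move=> pL.
have LE p q : L ((p *: s + q *: a) ^+ 2) =
    p ^+ 2 * L (s ^+ 2) + p * q * 2 * L (s * a) + q ^+ 2 * L (a ^+ 2).
  rewrite (_ : (_ + _) ^+ 2 =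
      p ^+ 2 *: s ^+ 2 + (p * q * 2) *: (s * a) + q ^+ 2 *: a ^+ 2).
    by rewrite !linearD !linearZ.
  rewrite sqrrD !exprZn -scalerAl -scalerAr scalerA -scaler_nat scalerA.
  by rewrite [2%:R * _]mulrC.
have := pL s; have := pL a; move: LE.
move: (L (s * a)) (L (s ^+ 2)) (L (a ^+ 2)) => Z X Y LE Y0 X0.
have q0 p q : 0 <= p ^+ 2 * X + p * q * 2 * Z + q ^+ 2 * Y by rewrite -LE.
have [X_eq0|X_neq0] := eqVneq X 0; last first.
  have X_gt0 : 0 < X by rewrite lt_neqAle eq_sym X_neq0.
  have := q0 (- Z) X; rewrite (_ : _ + _ = X * (X * Y - Z ^+ 2)); last by ring.
  by rewrite pmulr_rge0// subr_ge0.
rewrite X_eq0 mul0r; have [->|Z0] := eqVneq Z 0; first by rewrite expr0n.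
(* With [X = 0] and [q = 1] the form is affine in [p]; this [p] gives it the negative value
   [- Y - 2]. *)
have := q0 (- (Y + 1) / Z) 1; rewrite X_eq0.
rewrite (_ : _ + _ = - (2 * (Y + 1)) + Y); last by field.
by lra.
Qed.

(** By Cauchy-Schwarz the sequence [u] is log-convex and [u k ^+ 2] is at most a constant times
    [(B ^+ 2) ^+ (2 * k)]. The constant, and [C] with it, disappears from the conclusion: a growth
    bound up to a factor becomes an exact ratio bound. *)
Lemma psd_growth L C B a s : psd L -> 0 < B ->
  (forall n, L (a ^+ (2 * n)) <= C * B ^+ (2 * n)) ->
  L (s ^+ 2 * a ^+ 2) <= B ^+ 2 * L (s ^+ 2).
Proof.
move=> pL B0 LB; pose u k := L (s ^+ 2 * a ^+ (2 * k)).
have uE k : u k = L ((s * a ^+ k) ^+ 2) by rewrite /u exprMn -exprM mulnC.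
suff : u 1%N <= B ^+ 2 * u 0%N by rewrite /u expr0 mulr1.
apply: (@logconvex_le R u (L ((s ^+ 2) ^+ 2) * C)) => [|k|k|k].
- exact: exprn_gt0.
- by rewrite uE; exact: pL.
- rewrite (_ : u k.+1 = L ((s * a ^+ k) * (s * a ^+ k.+2))).
    by rewrite !uE; exact: psd_cauchy_schwarz.
  by rewrite /u mulrACA -expr2 -exprD mul2n -addnn addSnnS.
- apply: (le_trans (psd_cauchy_schwarz _ _ pL)).
  rewrite -mulrA; apply: ler_wpM2l; first exact: pL.
  by rewrite -!exprM [(2 * k * 2)%N]mulnC; exact: LB.
Qed.

(** A set of plain functions, so that it lies in a product of lines, where Tychonoff's theorem
    applies. *)
Definition states (b : A -> R) : set {ptws A -> R} :=
  [set l | exists L : {scalar A}, [/\ l = L :> (A -> R), psd L, L 1 = 1 &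
     forall a n, L (a ^+ (2 * n)) <= b a ^+ (2 * n)]].

Lemma statesP b (l : {ptws A -> R}) :
  (forall k x y, l (k *: x + y) = k * l x + l y) ->
  (forall a, 0 <= (l (a ^+ 2) : R)) -> (l 1 : R) = 1 ->
  (forall a n, (l (a ^+ (2 * n)) : R) <= b a ^+ (2 * n)) -> states b l.
Proof.
move=> lL pl l1 lb.
pose m := GRing.isLinear.Build R A R *%R (l : A -> R) lL.
by exists (HB.pack_for {scalar A} (l : A -> R) m).
Qed.

Variable b : A -> R.
Hypothesis b_gt0 : forall a, 0 < b a.

(** Cauchy-Schwarz for [s] and [s * c] leaves the factor [L (s ^+ 2 * c ^+ 2)], which [psd_growth]
    bounds with [C = 1]. *)
Lemma state_norm_sqr_le L c s : psd L ->
  (forall n, L (c ^+ (2 * n)) <= b c ^+ (2 * n)) ->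
  `|L (s ^+ 2 * c)| <= b c * L (s ^+ 2).
Proof.
move=> pL Lb; have Ls := pL s; have bc := ltW (b_gt0 c).
rewrite -ler_sqr ?nnegrE ?mulr_ge0// real_normK ?num_real//.
rewrite expr2 -mulrA -expr2; apply: le_trans (psd_cauchy_schwarz _ _ pL) _.
rewrite exprMn [b c * _]mulrC -[leRHS]mulrA; apply: ler_wpM2l => //.
have := @psd_growth L 1 (b c) c s pL (b_gt0 c).
rewrite (_ : b c * (_ * b c) = b c ^+ 2 * L (s ^+ 2)); last by ring.
by apply => n; rewrite mul1r.
Qed.

Lemma state_norm_le L a : psd L -> L 1 = 1 ->
  (forall n, L (a ^+ (2 * n)) <= b a ^+ (2 * n)) -> `|L a| <= b a.
Proof.
move=> pL L1 Lb; have := state_norm_sqr_le 1 pL Lb.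
by rewrite expr1n mul1r L1 mulr1.
Qed.

(** The functional [x |-> L (d * x)] inherits the growth bound only up to the factor [N].
    [psd_growth] removes [N], and induction on [n] then gives the exact bound relative to [L d]. *)
Lemma state_mul L d N : psd L ->
  (forall a n, L (a ^+ (2 * n)) <= b a ^+ (2 * n)) ->
  0 < L d -> (forall s, 0 <= L (d * s ^+ 2) <= N * L (s ^+ 2)) ->
  states b (fun x => L (d * x) / L d).
Proof.
move=> pL Lb Ld LN.
have N0 : 0 <= N.
  have /andP[] := LN 1; rewrite expr1n mulr1 => _ /(lt_le_trans Ld).
  by have := pL 1; rewrite expr1n; nra.
have lD k x y : L (d * (k *: x + y)) = k * L (d * x) + L (d * y).
  by rewrite mulrDr -scalerAr linearP.
pose M : {scalar A} := HB.pack_for {scalar A} (fun x : A => L (d * x))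
  (GRing.isLinear.Build R A R *%R (fun x : A => L (d * x)) lD).
have pM : psd M by move=> a; have /andP[] := LN a.
have Mb a n : M (a ^+ (2 * n)) <= N * b a ^+ (2 * n).
  have /andP[_] := LN (a ^+ n); rewrite -exprM mulnC => /le_trans; apply.
  exact: ler_wpM2l.
apply: statesP => [k x y|a||a n].
- by rewrite lD mulrDl mulrA.
- by apply: divr_ge0; [exact: pM|exact: ltW].
- by rewrite mulr1 divff// gt_eqF.
rewrite ler_pdivrMr//; elim: n => [|n ih].
  by rewrite muln0 !expr0 mul1r mulr1.
rewrite mulnS addnC 2!exprD.
have := @psd_growth M N (b a) a (a ^+ n) pM (b_gt0 a) (Mb a).
rewrite -exprM mulnC => /le_trans; apply.
apply: le_trans (ler_wpM2l (sqr_ge0 (b a)) ih) _.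
by rewrite mulrA [b a ^+ 2 * _]mulrC.
Qed.

(** By [state_norm_le] the states lie in a Tychonoff box, in which they are cut out by closed
    conditions on finitely many coordinates each. *)
Lemma states_compact : compact (states b).
Proof.
have ev (a : A) : continuous (fun f : {ptws A -> R} => f a : R).
  exact: (@proj_continuous A (fun _ => R) a).
have cbox : compact [set f : {ptws A -> R} | forall a,
    (`[- b a, b a]%classic : set R) (f a)].
  exact: (@tychonoff A (fun _ => R) _ (fun a => @segment_compact R _ _)).
pose E (p : R * A * A) : set {ptws A -> R} :=
  [set f | (f (p.1.1 *: p.1.2 + p.2) : R) = p.1.1 * (f p.1.2 : R) + (f p.2 : R)].
have cE p : closed (E p) := closed_eq_lin (k := p.1.1) (ev _) (ev p.1.2) (ev p.2).
pose E1 : set {ptws A -> R} := [set f | (f 1 : R) = 1].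
have cE1 : closed E1.
  apply: (@closed_eq_fun _ R (fun f : {ptws A -> R} => f 1 : R) (fun=> 1)).
    exact: ev.
  exact: cst_continuous.
pose P a : set {ptws A -> R} := [set f | 0 <= (f (a ^+ 2) : R)].
have cP a : closed (P a).
  apply: (@closed_comp _ _ (fun f : {ptws A -> R} => f (a ^+ 2) : R)
      [set x | 0 <= x]).
    by move=> x _; exact: ev.
  exact: closed_ge.
pose B (p : A * nat) : set {ptws A -> R} :=
  [set f | (f (p.1 ^+ (2 * p.2)) : R) <= b p.1 ^+ (2 * p.2)].
have cB p : closed (B p).
  apply: (@closed_comp _ _ (fun f : {ptws A -> R} => f (p.1 ^+ (2 * p.2)) : R)
      [set x | x <= b p.1 ^+ (2 * p.2)]).
    by move=> x _; exact: ev.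
  exact: closed_le.
rewrite (_ : states b = [set f : {ptws A -> R} | forall a,
      (`[- b a, b a]%classic : set R) (f a)] `&`
    (E1 `&` (\bigcap_p E p `&` (\bigcap_a P a `&` \bigcap_p B p)))).
  apply: compact_closedI => //; do 3?apply: closedI => //; exact: closed_bigI.
apply/seteqP; split => f.
  move=> [L [-> pL L1 Lb]]; split; last first.
    split; first exact: L1.
    split=> [p _|]; first exact: linearP.
    by split=> [a _|p _]; [exact: pL|exact: Lb].
  by move=> a /=; rewrite in_itv/= -ler_norml; exact: state_norm_le.
move=> [_ [f1 [fL [fP fB]]]]; apply: statesP.
- by move=> k x y; exact: (fL (k, x, y)).
- by move=> a; exact: fP.
- exact: f1.
- by move=> a n; exact: (fB (a, n)).
Qed.

End psd_functionals.

(** * Extreme states are characters *)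

Lemma ptws_eval_continuous (R : realType) (A : choiceType) (a : A) :
  continuous (fun f : {ptws A -> R} => f a : R).
Proof. exact: (@proj_continuous A (fun _ => R) a). Qed.

Lemma ptws_hausdorff (R : realType) (A : choiceType) :
  hausdorff_space {ptws A -> R}.
Proof. by apply: hausdorff_product => a; exact: Rhausdorff. Qed.

Section extreme_states.
Variables (R : realType) (A : comAlgType R) (b : A -> R).
Hypothesis b_gt0 : forall a, 0 < b a.
Implicit Types (F G : set {ptws A -> R}) (c : A).

(** Closed extreme subsets of the set of states, as in the proof of the Krein-Milman theorem. *)
Definition face F := [/\ F `<=` states b, closed F &
  forall (x y z : {ptws A -> R}) (t : R), states b x -> states b y ->
    0 < t < 1 -> F z ->
    (forall c, (z c : R) = t * (x c : R) + (1 - t) * (y c : R)) -> F x /\ F y].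

Definition argmin_on c F : set {ptws A -> R} :=
  [set l | F l /\ forall l', F l' -> (l c : R) <= l' c].

Lemma face_compact F : face F -> compact F.
Proof.
move=> [FS cF _]; apply: (subclosed_compact cF _ FS).
exact: states_compact.
Qed.

(** Evaluation at [c] is affine, so a proper convex combination attains the minimum only if both of
    its ends do. *)
Lemma argmin_face F c : face F -> face (argmin_on c F).
Proof.
move=> fF; have [FS cF Fx] := fF; split.
- by move=> l [/FS].
- rewrite (_ : argmin_on c F = F `&` \bigcap_(l' in F)
      ((fun l : {ptws A -> R} => l c : R) @^-1` [set r | r <= l' c])); last first.
    by apply/seteqP; split=> l [Fl lF]; split.
  apply: closedI => //; apply: closed_bigI => l' _.
  apply: closed_comp; last exact: closed_le.
  by move=> x _; exact: ptws_eval_continuous.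
move=> x y z t Sx Sy t01 [Fz zF] zE.
have [Fx0 Fy0] := Fx x y z t Sx Sy t01 Fz zE.
have := zF _ Fx0; have := zF _ Fy0; have /andP[t0 t1] := t01.
rewrite zE => zy zx.
have xy : (x c : R) = y c by nra.
have zxE : t * x c + (1 - t) * y c = x c by rewrite -xy; ring.
split; split=> // l' /zF; rewrite zE zxE// xy//.
Qed.

Lemma argmin_nonempty F c : face F -> F !=set0 -> argmin_on c F !=set0.
Proof.
move=> fF F0.
have [] := @compact_EVT_min _ R (fun l : {ptws A -> R} => l c : R) F F0.
- exact: face_compact.
- by apply: continuous_subspaceT; exact: ptws_eval_continuous.
move=> l /set_mem Fl lF; exists l; split=> // l' Fl'.
by apply: lF; rewrite inE.
Qed.

(** [Zorn_bigcup] produces maximal sets, so it is applied to the sets [X] whose removal from [F]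
    leaves a nonempty face; a maximal [X] leaves a minimal face. *)
Lemma exists_min_face F : face F -> F !=set0 ->
  exists G, [/\ face G, G !=set0, G `<=` F &
    forall H, face H -> H !=set0 -> H `<=` G -> G `<=` H].
Proof.
move=> fF F0; have [FS cF Fx] := fF.
pose P X := face (F `\` X) /\ F `\` X !=set0.
have [|X [[fX X0] maxX]] := @Zorn_bigcup _ P.
  move=> C CP totC.
  have FCE : F `\` \bigcup_(X in C) X = F `&` \bigcap_(X in C) (F `\` X).
    apply/seteqP; split=> l [Fl lC]; split=> //.
      by move=> X CX; split=> // Xl; apply: lC; exists X.
    by move=> [X CX Xl]; have [] := lC _ CX.
  have cFC : closed (F `\` \bigcup_(X in C) X).
    rewrite FCE; apply: closedI => //; apply: closed_bigI => X /CP[[]]//.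
  split.
    split=> //; first by move=> l [/FS].
    move=> x y z t Sx Sy t01 [Fz zC] zE.
    have [Fx0 Fy0] := Fx x y z t Sx Sy t01 Fz zE.
    have h X : C X -> ~ X x /\ ~ X y.
      move=> CX; have [[_ _ XF] _] := CP _ CX.
      have Xz : (F `\` X) z by split=> // Xz; apply: zC; exists X.
      by have [[_ ?] [_ ?]] := XF x y z t Sx Sy t01 Xz zE.
    by split; split=> // -[X CX]; have [] := h _ CX.
  have [->|/set0P[X0 CX0]] := eqVneq C set0.
    by rewrite bigcup_set0 setD0.
  (* For a nonempty chain the remainders form a filter base on the compact set [F]. A cluster point
     lies in all of them because they are closed. *)
  pose B X := F `\` X.
  have Bfil : Filter (filter_from C B).
    apply: filter_from_filter; first by exists X0.
    move=> X Y CX CY; have [XY|YX] := totC _ _ CX CY.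
      by exists Y => // l [Fl Yl]; split; split=> // /XY.
    by exists X => // l [Fl Xl]; split; split=> // /YX.
  have Bprop : ProperFilter (filter_from C B).
    by apply: filter_from_proper => X /CP[].
  have [|l [Fl cl]] := face_compact fF Bprop; first by exists X0 => // l [].
  exists l; rewrite FCE; split=> // X CX.
  have [[_ cX _] _] := CP _ CX; apply: cX.
  by move: cl; rewrite clusterE; apply; exists X.
exists (F `\` X); split=> // H fH H0 HX l [Fl Xl].
(* If [l] were outside [H], the complement of [H] would be a proper superset of [X] satisfying
   [P]. *)
apply: contrapT => Hl; apply: (maxX (~` H)).
  split; first by move=> k Xk Hk; have [] := HX _ Hk.
  by move/(_ _ Hl).
rewrite /P setDE setCK.
by rewrite (_ : F `&` H = H)//; apply/setIidr => k /HX[].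
Qed.

Lemma states_face : face (states b).
Proof.
split=> //; apply: compact_closed; [exact: ptws_hausdorff|exact: states_compact].
Qed.

(* An extreme state [z] is a convex combination of the normalizations of
   [x |-> z ((M + c) * x)] and [x |-> z ((M - c) * x)], hence equal to both. *)
Lemma constant_face_character G z : face G -> G z ->
  (forall x, G x -> x = z) -> bounded_characters b z.
Proof.
move=> [GS cG Gx] Gz G1; have [L [zE pL L1 Lb]] := GS _ Gz.
have Lnorm c : `|L c| <= b c by apply: state_norm_le => //; exact: Lb.
split; last by move=> a; rewrite zE.
apply/charactersP; split=> [|c x|k x y]; rewrite zE//; last exact: linearP.
(* Strictly larger than [b c], hence than the absolute value of [L c], so that both normalizing
   constants [L (M + c)] and [L (M - c)] are positive. *)
pose M := b c + 1.
have M0 : 0 < M by rewrite ltr_pwDr// ltW.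
have LM (e : R) (v : A) : L ((M *: 1 + e *: c) * v) = M * L v + e * L (c * v).
  by rewrite mulrDl -!scalerAl mul1r linearD !linearZ.
have LM1 (e : R) : L (M *: 1 + e *: c) = M + e * L c.
  by rewrite linearD !linearZ /= L1 mulr1.
have dpos (e : R) : `|e| = 1 -> 0 < L (M *: 1 + e *: c).
  move=> e1; rewrite LM1.
  have : `|e * L c| <= b c by rewrite normrM e1 mul1r.
  by rewrite ler_norml /M => /andP[? _]; lra.
have dstate (e : R) : `|e| = 1 -> states b (fun v =>
    L ((M *: 1 + e *: c) * v) / L (M *: 1 + e *: c)).
  move=> e1; apply: (@state_mul _ _ b b_gt0 L (M *: 1 + e *: c) (2 * M)) => // [|s].
    exact: dpos.
  rewrite LM; have : `|e * L (c * s ^+ 2)| <= b c * L (s ^+ 2).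
    by rewrite normrM e1 mul1r mulrC; apply: state_norm_sqr_le.
  have := pL s; rewrite ler_norml /M => ? /andP[? ?].
  by apply/andP; split; lra.
clearbody M.
have n1 : `|1 : R| = 1 by rewrite normr1.
have nN1 : `|- 1 : R| = 1 by rewrite normrN1.
(* The normalizing constants add up to [2 * M], which determines the weights of the convex
   combination. *)
have [||v|/G1 + _] := Gx _ _ z (L (M *: 1 + 1 *: c) / (2 * M))
  (dstate 1 n1) (dstate (-1) nN1).
- rewrite divr_gt0 ?dpos ?mulr_gt0//= ltr_pdivrMr ?mulr_gt0//.
  by have := dpos _ nN1; rewrite !LM1; lra.
- exact: Gz.
- rewrite zE /= !LM; have := dpos _ nN1; have := dpos _ n1.
  rewrite !LM1; move: M0 (L c) (L v) (L (c * v)); clear => M0 p q r.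
  by move=> ? ?; field; do ?[apply/andP; split]; apply/eqP; lra.
(* At [x] this reads [L ((M + c) * x) = L (M + c) * L x], where the terms in [M] cancel and
   multiplicativity remains. *)
move=> /(congr1 (fun f : {ptws A -> R} => f x : R)) /=.
have := dpos _ n1; rewrite zE !LM !LM1 => d0 /(canRL (divfK _)).
by rewrite gt_eqF// => /(_ isT); lra.
Qed.

(** Take a minimal face inside the face of states minimizing evaluation at [a]. By minimality it
    equals each of its own [argmin_on c], so all evaluations are constant on it and it is a single
    point. *)
Lemma states_character_le (l : {ptws A -> R}) a : states b l ->
  exists2 alpha : {ptws A -> R}, bounded_characters b alpha &
    (alpha a : R) <= l a.
Proof.
move=> Sl; have fS := states_face.
have S0 : states b !=set0 by exists l.
have [G [fG [z Gz] Ga minG]] := exists_min_face (argmin_face a fS)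
  (argmin_nonempty a fS S0).
exists z; last by have [_ ->] := Ga _ Gz.
apply: (constant_face_character fG Gz) => x Gx; apply/funext => c.
have Gc : G `<=` argmin_on c G.
  apply: minG; [exact: argmin_face|apply: argmin_nonempty => //; by exists z|].
  by move=> ? [].
by apply/eqP; rewrite eq_le (Gc _ Gx).2// (Gc _ Gz).2.
Qed.

(** This supplies the positivity hypothesis [L_ge0] from which the measure is built. *)
Lemma states_ge0 (L : {scalar A}) a : psd L -> L 1 = 1 ->
  (forall a n, L (a ^+ (2 * n)) <= b a ^+ (2 * n)) ->
  (forall alpha, bounded_characters b alpha -> 0 <= (alpha a : R)) -> 0 <= L a.
Proof.
move=> pL L1 Lb a0.
have [|alpha /a0 ? aL] := @states_character_le L a; first by exists L.
exact: le_trans aL.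
Qed.

End extreme_states.

(** * Separation of compact sets of characters *)

Lemma exists_natmul_ge (R : realType) (d M : R) : 0 < d ->
  exists n, M <= 1 + d *+ n.
Proof.
move=> d0; exists (Num.bound (`|M| / d)).
have := archi_boundP (divr_ge0 (normr_ge0 M) (ltW d0)).
rewrite ltr_pdivrMr// mulr_natl => h.
by rewrite (le_trans (ler_norm M))// (le_trans (ltW h))// lerDr.
Qed.

(** Multiply [(1 - y) ^+ n] by [(1 + y) ^+ n]: the product is at most 1, and Bernoulli's inequality
    bounds the second factor below. *)
Lemma expr_onem_le (R : realType) (y : R) n : 0 <= y <= 1 ->
  (1 - y) ^+ n <= (1 + y *+ n)^-1.
Proof.
move=> /andP[y0 y1]; have yn : 0 < 1 + y *+ n by rewrite ltr_pwDl// mulrn_wge0.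
rewrite -[leRHS]mul1r ler_pdivlMr//.
apply: (@le_trans _ _ ((1 - y) ^+ n * (1 + y) ^+ n)).
  rewrite ler_wpM2l ?exprn_ge0 ?subr_ge0//.
  by apply: bernoulli_ineq; lra.
rewrite -exprMn exprn_ile1//; first by rewrite mulr_ge0//; lra.
by have := mulr_ge0 y0 y0; lra.
Qed.

(* The polynomials of Brosowski and Deutsch's proof of the Stone-Weierstrass
   theorem. *)
Lemma exists_step_exponent (R : realType) (e : R) : 0 < e ->
  exists n, forall x : R, 0 <= x <= 1 ->
   [/\ 0 <= (1 - x ^+ n) ^+ (2 ^ n) <= 1,
     (x <= 1 / 4 -> 1 - e <= (1 - x ^+ n) ^+ (2 ^ n)) &
     (3 / 4 <= x -> (1 - x ^+ n) ^+ (2 ^ n) <= e)].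
Proof.
move=> e0; have [n ne] := @exists_natmul_ge _ (1 / 2) e^-1 ltac:(lra).
exists n => x /andP[x0 x1].
have xn0 : 0 <= x ^+ n by exact: exprn_ge0.
have xn1 : x ^+ n <= 1 by exact: exprn_ile1.
have eE : (1 + (1 / 2) *+ n)^-1 <= e.
  by rewrite -[e]invrK lef_pV2// posrE ?invr_gt0// (lt_le_trans _ ne)// invr_gt0.
(* The exponent [2 ^ n] brings [(2 * x) ^+ n] into Bernoulli's inequality. This is at most
   [(1 / 2) ^+ n] for [x <= 1 / 4] and at least [1 + (1 / 2) *+ n] for [3 / 4 <= x], so the choice
   of [n] settles both cases. *)
have xnE : x ^+ n *+ (2 ^ n) = (2 * x) ^+ n.
  by rewrite exprMn -[LHS]mulr_natl natrX.
split.
- by rewrite exprn_ge0 ?subr_ge0//= exprn_ile1 ?subr_ge0// lerBlDr lerDl.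
- move=> x4; have := @bernoulli_ineq _ (- x ^+ n) (2 ^ n) ltac:(lra).
  rewrite mulNrn xnE; apply: le_trans.
  rewrite lerB//; apply: le_trans eE.
  have h1 : (2 * x) ^+ n <= (1 / 2) ^+ n.
    by rewrite lerXn2r ?nnegrE//; lra.
  apply: (le_trans h1); have := @expr_onem_le _ (1 / 2) n ltac:(lra).
  by rewrite (_ : 1 - 1 / 2 = 1 / 2)//; field.
- move=> x4; apply: le_trans eE.
  apply: le_trans (expr_onem_le _ _) _; first by rewrite xn0.
  rewrite xnE lef_pV2 ?posrE; last 2 first.
  - by rewrite ltr_pwDl// exprn_ge0// mulr_ge0.
  - by rewrite ltr_pwDl// mulrn_wge0; lra.
  apply: (@le_trans _ _ (1 + (2 * x - 1) *+ n)).
    by rewrite lerD2l lerMn2r; apply/orP; right; lra.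
  apply: (le_trans (bernoulli_ineq _ _)); first by lra.
  by rewrite addrCA subrr addr0 lerDr.
Qed.

Lemma prod_unit (R : realDomainType) (I : eqType) (s : seq I) (F : I -> R) :
  (forall i, i \in s -> 0 <= F i <= 1) -> 0 <= \prod_(i <- s) F i <= 1.
Proof.
move=> F01; rewrite !big_seq; elim/big_ind: _ => [|x y|i si].
- by rewrite ler01 lexx.
- by move=> /andP[? ?] /andP[? ?]; rewrite mulr_ge0//= mulr_ile1.
- exact: F01.
Qed.

Lemma prod_unit_le (R : realDomainType) (I : eqType) (s : seq I) (F : I -> R)
    (e : R) i :
  (forall i, i \in s -> 0 <= F i <= 1) -> i \in s -> F i <= e ->
  \prod_(i <- s) F i <= e.
Proof.
move=> F01 si Fi; rewrite (big_rem i)//=; apply: le_trans Fi.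
have /andP[? ?] := F01 i si.
have rF j : j \in rem i s -> 0 <= F j <= 1 by move=> /mem_rem; exact: F01.
have /andP[? ?] := prod_unit rF.
by rewrite ler_piMr.
Qed.

Lemma prod_ge_onem (R : realDomainType) (I : eqType) (s : seq I) (F : I -> R)
    (e : R) :
  0 <= e <= 1 -> (forall i, i \in s -> 1 - e <= F i) ->
  1 - e *+ size s <= \prod_(i <- s) F i.
Proof.
move=> /andP[e0 e1] Fe; rewrite -mulNrn.
apply: le_trans (bernoulli_ineq _ _) _; first by lra.
elim: s Fe => [|i s ih] Fe; first by rewrite big_nil expr0.
rewrite big_cons exprS ler_pM ?exprn_ge0 ?subr_ge0//.
  by rewrite Fe ?mem_head.
by apply: ih => j sj; rewrite Fe// in_cons sj orbT.
Qed.

Section separation.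
Variables (R : realType) (A : comAlgType R) (b : A -> R).
Hypothesis b_gt0 : forall a, 0 < b a.
Notation K := (bounded_characters b).
Implicit Types (C D : set {ptws A -> R}) (alpha beta : {ptws A -> R}).

Definition unit_valued (g : A) :=
  forall alpha, K alpha -> 0 <= (alpha g : R) <= 1.

(** Each [beta] in [C] differs from [alpha] at some [a], where the square [q a] is positive at
    [beta] and zero at [alpha]. By compactness a finite sum [p0] of such squares is positive on all
    of [C]; dividing by [b p0] brings its values into [0, 1]. *)
Lemma separate_point_compact alpha C : K alpha -> compact C -> C `<=` K ->
  ~ C alpha -> exists2 p : A, unit_valued p &
  (alpha p : R) = 0 /\ exists2 d : R, 0 < d & forall beta, C beta -> d <= beta p.
Proof.
move=> Ka cC CK Ca; have [[f fE] fb] := Ka.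
pose q a := (a - f a *: 1) ^+ 2.
have qE beta a : K beta -> (beta (q a) : R) = (beta a - f a) ^+ 2.
  by move=> [[g ->] _]; rewrite rmorphXn rmorphB /= linearZ rmorph1 /= mulr1.
pose U a : set {ptws A -> R} := [set beta | 0 < (beta (q a) : R)].
have oU a : open (U a).
  apply: (@open_comp _ _ (fun g : {ptws A -> R} => g (q a) : R) [set x | 0 < x]).
    by move=> x _; exact: ptws_eval_continuous.
  exact: open_gt.
have CU : C `<=` \bigcup_a U a.
  move=> beta Cb; apply: contrapT => nU; apply: Ca.
  rewrite (_ : alpha = beta)//; apply/funext => a; apply/eqP; rewrite eq_sym.
  rewrite -subr_eq0; apply: contrapT => /negP ab; apply: nU; exists a => //.
  by rewrite /U /= qE; [rewrite exprn_even_gt0//= -fE|exact: CK].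
have := cC; rewrite compact_cover => /(_ A setT U (fun a _ => oU a) CU)[D _ CD].
pose p0 := \sum_(a <- D) q a.
have p0E beta : K beta -> (beta p0 : R) = \sum_(a <- D) (beta a - f a) ^+ 2.
  move=> Kb; have [[g gE] _] := Kb; rewrite gE rmorph_sum /=.
  by apply: eq_bigr => a _; have := qE _ a Kb; rewrite gE.
have p0_ge0 beta : K beta -> 0 <= (beta p0 : R).
  by move=> Kb; rewrite p0E//; apply: sumr_ge0 => a _; exact: sqr_ge0.
have b0 := b_gt0 p0.
pose p := (b p0)^-1 *: p0.
have pE beta : K beta -> (beta p : R) = (b p0)^-1 * beta p0.
  by move=> [[g ->] _]; rewrite linearZ.
exists p.
  move=> beta Kb; rewrite pE// mulr_ge0 ?invr_ge0 ?(ltW b0) ?p0_ge0//=.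
  rewrite ler_pdivrMl// mulr1; apply: le_trans (ler_norm _) _.
  by have [_] := Kb; exact.
split.
  have p00 : (alpha p0 : R) = 0.
    by rewrite p0E//; apply: big1 => a _; rewrite fE subrr expr0n.
  by rewrite pE// p00 mulr0.
have p_gt0 beta : C beta -> 0 < (beta p : R).
  move=> Cb; have Kb := CK _ Cb; rewrite pE// mulr_gt0 ?invr_gt0// lt_neqAle.
  rewrite p0_ge0// andbT eq_sym p0E//; have [a aD] := CD _ Cb.
  rewrite /U /= qE// => a0; rewrite psumr_eq0; last by move=> ? _; exact: sqr_ge0.
  by apply/negP => /allP/(_ a aD) /=; rewrite gt_eqF.
have [C0|/set0P C0] := eqVneq C set0.
  by exists 1 => // beta; rewrite C0.
have [||beta /set_mem Cb bmin] :=
  @compact_EVT_min _ R (fun l : {ptws A -> R} => l p : R) C C0.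
- exact: cC.
- by apply: continuous_subspaceT; exact: ptws_eval_continuous.
exists (beta p); first exact: p_gt0.
by move=> ? ?; apply: bmin; rewrite inE.
Qed.

(** A high power of [1 - p], with [p] from [separate_point_compact], stays 1 at [alpha] and becomes
    small on [C]. *)
Lemma separate_point_compact_quarter alpha C : K alpha -> compact C ->
  C `<=` K -> ~ C alpha -> exists2 g : A, unit_valued g &
  (alpha g : R) = 1 /\ forall beta, C beta -> (beta g : R) <= 1 / 4.
Proof.
move=> Ka cC CK Ca.
have [p p01 [ap [d d0 dp]]] := separate_point_compact Ka cC CK Ca.
have [n n4] := exists_natmul_ge 4 d0.
have gE beta : K beta -> (beta ((1 - p) ^+ n) : R) = (1 - beta p) ^+ n.
  by move=> [[g ->] _]; rewrite rmorphXn rmorphB rmorph1.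
exists ((1 - p) ^+ n).
  move=> beta Kb; rewrite gE//; have /andP[? ?] := p01 _ Kb.
  by rewrite exprn_ge0 ?subr_ge0//= exprn_ile1 ?subr_ge0// lerBlDr lerDl.
split; first by rewrite gE// ap subr0 expr1n.
move=> beta Cb; have Kb := CK _ Cb; rewrite gE//.
apply: le_trans (expr_onem_le _ (p01 _ Kb)) _.
rewrite mul1r lef_pV2 ?posrE//; last first.
  by rewrite ltr_pwDl// mulrn_wge0//; have /andP[] := p01 _ Kb.
by apply: (le_trans n4); rewrite lerD2l lerMn2r dp// orbT.
Qed.

(** Finitely many elements, each at most 1/4 on [D], have their sets of values above 3/4 covering
    [C]. The step polynomial of each is close to 1 on [D] and close to 0 on its part of [C]; the
    product of these polynomials separates. *)
Lemma separate_compacts C D (e : R) : compact C -> compact D ->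
  C `<=` K -> D `<=` K -> C `&` D = set0 -> 0 < e ->
  exists2 g : A, unit_valued g &
  (forall alpha, C alpha -> (alpha g : R) <= e) /\
  (forall alpha, D alpha -> 1 - e <= (alpha g : R)).
Proof.
move=> cC cD CK DK CD0 e0.
pose I : set A := [set a | unit_valued a /\ forall beta, D beta -> (beta a : R) <= 1 / 4].
pose U a : set {ptws A -> R} := [set beta | 3 / 4 < (beta a : R)].
have oU a : open (U a).
  apply: (@open_comp _ _ (fun g : {ptws A -> R} => g a : R) [set x | 3 / 4 < x]).
    by move=> x _; exact: ptws_eval_continuous.
  exact: open_gt.
have CU : C `<=` \bigcup_(a in I) U a.
  move=> alpha Ca; have nDa : ~ D alpha.
    by move=> Da; have : (C `&` D) alpha by []; rewrite CD0.
  have [g g01 [ag gD]] := separate_point_compact_quarter (CK _ Ca) cD DK nDa.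
  by exists g => //; rewrite /U /= ag; lra.
move: cC; rewrite compact_cover => /(_ A I U (fun a _ => oU a) CU)[J JI CJ].
pose m := size J.
(* A product of [m] factors that are at least [1 - e'] loses at most [e' *+ m]. The successor keeps
   the denominator positive for an empty cover, and the minimum with 1 makes [e' <= 1] for
   Bernoulli's inequality. *)
pose e' := Num.min e 1 / m.+1%:R.
have e'0 : 0 < e' by rewrite divr_gt0// lt_min e0/=.
have e'e : e' *+ m.+1 <= e.
  by rewrite -mulr_natr divfK ?pnatr_eq0// ge_min lexx.
have e'1 : e' *+ m.+1 <= 1.
  by rewrite -mulr_natr divfK ?pnatr_eq0// ge_min lexx orbT.
have e'm : 0 <= e' *+ m by rewrite mulrn_wge0// ltW.
rewrite mulrS in e'e e'1.
have [n nP] := exists_step_exponent e'0.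
pose g := \prod_(a <- J) (1 - a ^+ n) ^+ (2 ^ n).
have gE alpha : K alpha ->
    (alpha g : R) = \prod_(a <- J) (1 - (alpha a) ^+ n) ^+ (2 ^ n).
  move=> [[h ->] _]; rewrite rmorph_prod; apply: eq_bigr => a _.
  by rewrite rmorphXn rmorphB rmorphXn rmorph1.
have F01 alpha a : K alpha -> a \in (J : seq A) ->
    0 <= (1 - (alpha a : R) ^+ n) ^+ (2 ^ n) <= 1.
  move=> Ka /JI /set_mem [a01 _].
  by have [] := nP _ (a01 _ Ka).
exists g; first by move=> alpha Ka; rewrite gE//; apply: prod_unit => a; exact: F01.
split=> alpha Xa.
  have Ka := CK _ Xa; have [a Ja Uaa] := CJ _ Xa; rewrite gE//.
  apply: (prod_unit_le (i := a)) => //; first by move=> i; exact: F01.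
  have /set_mem [a01 _] := JI _ Ja; have [_ _ h] := nP _ (a01 _ Ka).
  apply: (le_trans (h (ltW Uaa))); apply: le_trans e'e.
  by rewrite lerDl.
have Ka := DK _ Xa; rewrite gE//.
apply: (@le_trans _ _ (1 - e' *+ m)); first by lra.
apply: prod_ge_onem => [|a /JI /set_mem [a01 aD]]; first by lra.
have [_ h _] := nP _ (a01 _ Ka); apply: h; exact: aD.
Qed.

End separation.

(** * The outer measure of a positive functional *)

(** The Caratheodory sets form a sigma-algebra, which contains all Borel sets once it contains the
    open ones. *)
Lemma caratheodory_borel_measure (R : realType) (T : ptopologicalType)
    (mu : {outer_measure set T -> \bar R}) :
  (forall U : set T, open U -> mu.-caratheodory U) ->
  exists nu : {measure set (borelType T) -> \bar R}, forall B, nu B = mu B.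
Proof.
move=> opmu.
have sub (B : set (borelType T)) : measurable B -> mu.-caratheodory B.
  apply: smallest_sub; last exact: opmu.
  split.
  - exact: caratheodory_measurable_set0.
  - by move=> C mC; rewrite setTD; exact: caratheodory_measurable_setC.
  - by move=> F mF; exact: caratheodory_measurable_bigcup.
pose f : set (borelType T) -> \bar R := mu.
have f0 : f set0 = 0%E by exact: outer_measure0.
have fge0 B : (0 <= f B)%E by exact: outer_measure_ge0.
have fadd : semi_sigma_additive f.
  move=> F mF tF mUF; apply: (@caratheodory_measure_sigma_additive R T mu) => //.
    by move=> i; exact: sub.
  exact: sub.
pose m := isMeasure.Build _ (borelType T) R f f0 fge0 fadd.
by exists (HB.pack_for {measure set (borelType T) -> \bar R} f m).
Qed.

Section riesz.
Variables (R : realType) (A : comAlgType R) (b : A -> R).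
Hypothesis b_gt0 : forall a, 0 < b a.
Notation K := (bounded_characters b).
Notation T := {ptws A -> R}.
Implicit Types (U V : set T) (alpha beta : T).
Variable L : {scalar A}.
Hypothesis L1 : L 1 = 1.
Hypothesis L_ge0 : forall a, (forall alpha, K alpha -> 0 <= (alpha a : R)) ->
  0 <= L a.

Lemma eval_sub_cst alpha f (e : R) : K alpha ->
  (alpha (f - e *: 1) : R) = alpha f - e.
Proof.
move=> [/charactersP[a1 _ aL] _].
by rewrite addrC -scaleNr aL a1 mulr1 addrC.
Qed.

Lemma functional_le a c :
  (forall alpha, K alpha -> (alpha a : R) <= alpha c) -> L a <= L c.
Proof.
move=> ac; rewrite -subr_ge0 -linearB; apply: L_ge0 => alpha Ka.
by have := ac _ Ka; have [[f ->] _] := Ka; rewrite rmorphB subr_ge0.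
Qed.

Lemma bounded_characters_closed : closed K.
Proof.
apply: compact_closed; first exact: ptws_hausdorff.
exact: bounded_characters_compact.
Qed.

Lemma superlevel_compact a (e : R) : compact (K `&` [set alpha | e <= (alpha a : R)]).
Proof.
apply: compact_closedI; first exact: bounded_characters_compact.
apply: (@closed_comp _ _ (fun f : T => f a : R) [set x | e <= x]).
  by move=> x _; exact: ptws_eval_continuous.
exact: closed_ge.
Qed.

(* The elements of [A] whose evaluations on [K] do not exceed the indicator of
   [U]; they may take negative values. *)
Definition below U : set A := [set a | forall alpha, K alpha ->
  (alpha a : R) <= 1 /\ (~ U alpha -> (alpha a : R) <= 0)].

Definition inner U : \bar R := ereal_sup [set (L a)%:E | a in below U].

Lemma below_inner U a : below U a -> ((L a)%:E <= inner U)%E.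
Proof. by move=> Ua; apply: ereal_sup_ubound; exists a. Qed.

Lemma inner_le U c : (forall a, below U a -> ((L a)%:E <= c)%E) ->
  (inner U <= c)%E.
Proof. by move=> h; apply: ge_ereal_sup => _ [a Ua <-]; exact: h. Qed.

Lemma inner_ge0 U : (0 <= inner U)%E.
Proof.
have := @below_inner U 0; rewrite linear0; apply => alpha [[f ->] _].
by rewrite rmorph0; split.
Qed.

Lemma inner_le1 U : (inner U <= 1)%E.
Proof.
apply: inner_le => a Ua; rewrite lee_fin -L1; apply: functional_le => alpha Ka.
by have [+ _] := Ua _ Ka; have [[f ->] _] := Ka; rewrite rmorph1.
Qed.

Lemma inner_fin_num U : inner U \is a fin_num.
Proof.
rewrite ge0_fin_numE ?inner_ge0// (le_lt_trans (inner_le1 U))//.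
exact: ltry.
Qed.

Lemma le_inner U V : U `<=` V -> (inner U <= inner V)%E.
Proof.
move=> UV; apply: inner_le => a Ua; apply: below_inner => alpha Ka.
by have [? h] := Ua _ Ka; split=> // nV; apply: h => /UV.
Qed.

Lemma inner_adherent U (e : R) : 0 < e ->
  exists2 a, below U a & (inner U <= (L a + e)%:E)%E.
Proof.
move=> e0; have [_ [a Ua <-] h] := ub_ereal_sup_adherent e0 (inner_fin_num U).
by exists a => //; rewrite EFinD -leeBlDr// ltW.
Qed.

Lemma inner0 : inner set0 = 0%E.
Proof.
apply/eqP; rewrite eq_le inner_ge0 andbT; apply: inner_le => a a0.
rewrite lee_fin -(linear0 L); apply: functional_le => alpha Ka.
have [_ h] := a0 _ Ka; have := h (fun x => x).
by have [[f ->] _] := Ka; rewrite rmorph0.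
Qed.

Lemma innerT : inner setT = 1%E.
Proof.
apply/eqP; rewrite eq_le inner_le1/= -L1; apply: below_inner => alpha [[f ->] _].
by split=> [|/(_ I)//]; rewrite rmorph1.
Qed.

(** For [f] below the union, the parts of the compact set where [f] is at least [e] that lie outside
    [U] and outside [V] are disjoint. If [g] separates them, [f] splits into [f * g] and
    [f * (1 - g)], which after subtraction of [e] are below [U] and [V]. *)
Lemma innerU U V : open U -> open V ->
  (inner (U `|` V) <= inner U + inner V)%E.
Proof.
move=> oU oV; apply: inner_le => f fUV; apply/lee_addgt0Pr => e' e'0.
pose e : R := e' / 2; have e0 : 0 < e by rewrite divr_gt0.
have eE : e' = e + e by rewrite /e; field.
pose C W := (K `&` [set alpha | e <= (alpha f : R)]) `&` ~` W.
have cC W : open W -> compact (C W).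
  move=> oW; apply: compact_closedI; first exact: superlevel_compact.
  exact: open_closedC.
have CK W : C W `<=` K by move=> alpha [[]].
have [|g g01 [gU gV]] := separate_compacts b_gt0 (cC _ oU) (cC _ oV) (CK U) (CK V) _ e0.
  rewrite -subset0 => alpha [[[Ka /= af] nU] [_ nV]].
  have [_ h] := fUV _ Ka; have := h (fun UV => match UV with or_introl x => nU x
    | or_intror x => nV x end).
  by move=> ?; lra.
(* Outside [W], either [f] is less than [e], or the point is in [C W], where [h <= e] and [f <= 1];
   in both cases [f * h <= e]. *)
have below_mul (W : set T) h :
    unit_valued b h -> (forall alpha, C W alpha -> (alpha h : R) <= e) ->
    below W (f * h - e *: 1).
  move=> h01 hC alpha Ka; have /andP[h0 h1] := h01 _ Ka.
  have [f1 _] := fUV _ Ka.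
  have aE : (alpha (f * h - e *: 1) : R) = alpha f * alpha h - e.
    by rewrite eval_sub_cst//; have [[k ->] _] := Ka; rewrite rmorphM.
  split; first by rewrite aE; nra.
  move=> nW; rewrite aE; have [fe|/ltW fe] := leP e (alpha f).
    have := hC alpha (conj (conj Ka fe) nW) => he; nra.
  nra.
have h1 : below U (f * g - e *: 1) by exact: below_mul.
have gE alpha : K alpha -> (alpha (1 - g) : R) = 1 - alpha g.
  by move=> [[k ->] _]; rewrite rmorphB rmorph1.
have h2 : below V (f * (1 - g) - e *: 1).
  apply: below_mul.
    by move=> alpha Ka; have /andP[? ?] := g01 _ Ka; rewrite gE//; apply/andP; split; lra.
  by move=> alpha Ca; rewrite gE; [have := gV _ Ca; lra|exact: CK Ca].
rewrite -leeBlDr//; apply: le_trans (leeD (below_inner h1) (below_inner h2)).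
rewrite -EFinB -EFinD lee_fin -linearD /=.
rewrite (_ : f * g - e *: 1 + (f * (1 - g) - e *: 1) = f - e' *: 1).
  by rewrite linearB linearZ /= L1 mulr1.
by rewrite addrACA -mulrDr [g + _]addrC subrK mulr1 -opprD -scalerDl -eE.
Qed.

Lemma inner_bigU (F : (set T)^nat) n : (forall i, open (F i)) ->
  (inner (\big[setU/set0]_(i < n) F i) <= \sum_(i < n) inner (F i))%E.
Proof.
move=> oF; elim: n => [|n ih]; first by rewrite !big_ord0 inner0.
rewrite !big_ord_recr/=; apply: le_trans (innerU _ _) _ => //.
  by rewrite -bigcup_mkord; apply: bigcup_open => i _; exact: oF.
exact: leeD.
Qed.

(** The points of [K] where [f] is at least [e] form a compact set covered by finitely many [F i],
    so [f - e] is below a finite union. *)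
Lemma inner_bigcup (F : (set T)^nat) : (forall i, open (F i)) ->
  (inner (\bigcup_i F i) <= \sum_(0 <= i <oo) inner (F i))%E.
Proof.
move=> oF; apply: inner_le => f fF; apply/lee_addgt0Pr => e e0.
have := superlevel_compact (a := f) (e := e).
rewrite compact_cover => /(_ nat setT F (fun i _ => oF i)) [alpha [Ka /= ef]|D _ FD].
  apply: contrapT => nF; have [_ h] := fF _ Ka.
  by have := h nF; lra.
pose n := (\max_(i <- D) i).+1.
have h : below (\big[setU/set0]_(i < n) F i) (f - e *: 1).
  move=> alpha Ka; have [f1 _] := fF _ Ka.
  rewrite eval_sub_cst//; split; first by lra.
  move=> nF; rewrite subr_le0 leNgt; apply/negP => ef.
  have [i Di Fi] := FD alpha (conj Ka (ltW ef)); apply: nF.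
  rewrite -bigcup_mkord; exists i => //=.
  rewrite /n ltnS.
  exact: (@leq_bigmax_seq _ _ _ id i).
rewrite -leeBlDr// -EFinB (_ : L f - e = L (f - e *: 1)); last first.
  by rewrite linearB linearZ /= L1 mulr1.
apply: (le_trans (below_inner h)); apply: (le_trans (inner_bigU _ oF)).
rewrite -(big_mkord xpredT (fun i => inner (F i))).
by apply: nneseries_lim_ge => i _ _; exact: inner_ge0.
Qed.

Definition outer (X : set T) : \bar R :=
  ereal_inf [set inner U | U in [set U | open U /\ X `<=` U]].

Lemma outer_le_inner X U : open U -> X `<=` U -> (outer X <= inner U)%E.
Proof. by move=> oU XU; apply: ereal_inf_lbound; exists U. Qed.

Lemma outer_open U : open U -> outer U = inner U.
Proof.
move=> oU; apply/eqP; rewrite eq_le outer_le_inner//=.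
by apply: le_ereal_inf_tmp => _ [V [oV UV] <-]; exact: le_inner.
Qed.

Lemma outer_ge0 X : (0 <= outer X)%E.
Proof. by apply: le_ereal_inf_tmp => _ [V _ <-]; exact: inner_ge0. Qed.

Lemma outer_fin_num X : outer X \is a fin_num.
Proof.
rewrite ge0_fin_numE ?outer_ge0//.
by rewrite (le_lt_trans (outer_le_inner openT (@subsetT _ X)))// innerT ltry.
Qed.

Lemma outer_adherent X (e : R) : 0 < e ->
  exists U, [/\ open U, X `<=` U & (inner U <= outer X + e%:E)%E].
Proof.
move=> e0; have [_ [U [oU XU] <-] /ltW h] := lb_ereal_inf_adherent e0 (outer_fin_num X).
by exists U.
Qed.

Lemma le_outer : {homo outer : X Y / X `<=` Y >-> (X <= Y)%E}.
Proof.
move=> X Y XY; apply: le_ereal_inf_tmp => _ [V [oV YV] <-].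
by apply: outer_le_inner => //; exact: subset_trans YV.
Qed.

Lemma outer_sigma_subadditive : sigma_subadditive outer.
Proof.
move=> F; apply/lee_addgt0Pr => e e0.
have e2 i : 0 < e / (2 ^ i.+1)%:R by rewrite divr_gt0// ltr0n expn_gt0.
have /choice [U UP] := fun i => outer_adherent (F i) (e2 i).
apply: le_trans (epsilon_trick xpredT _ (ltW e0)); last first.
  by move=> n; exact: outer_ge0.
apply: (@le_trans _ _ (\sum_(0 <= i <oo) inner (U i))%E).
  apply: le_trans (inner_bigcup _); last by move=> i; have [] := UP i.
  apply: outer_le_inner; first by apply: bigcup_open => i _; have [] := UP i.
  by apply: subset_bigcup => i _; have [] := UP i.
apply: lee_nneseries => i _; first by move=> _; exact: inner_ge0.
by have [] := UP i.
Qed.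

Definition outer_measure_of : {outer_measure set T -> \bar R} :=
  HB.pack outer (isOuterMeasure.Build R T outer
    (etrans (outer_open open0) inner0) outer_ge0 le_outer outer_sigma_subadditive).

(** Given an open [V] containing [X], take [f] almost optimal below the intersection of [V] and [U],
    let [C] be the set where [f] is at least [e], and take [h] almost optimal below [V] minus [C].
    Then [f + h - e] is below [V]; since [C] lies in [U], the set [V] minus [C] still contains [X]
    minus [U]. *)
Lemma open_caratheodory U : open U -> outer_measure_of.-caratheodory U.
Proof.
move=> oU; apply: le_caratheodory_measurable => X.
rewrite [X in (X + _)%E]/= [X in (_ + X)%E]/= [X in (_ <= X)%E]/=.
apply: le_ereal_inf_tmp => _ [V [oV XV] <-]; apply/lee_addgt0Pr => e' e'0.
pose e : R := e' / 3; have e0 : 0 < e by rewrite divr_gt0.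
have eE : e' = e + e + e by rewrite /e; field.
clearbody e.
have [f fVU Lf] := inner_adherent (V `&` U) e0.
pose C := K `&` [set alpha | e <= (alpha f : R)].
have cC : closed C.
  apply: compact_closed; [exact: ptws_hausdorff|exact: superlevel_compact].
have oW : open (V `&` ~` C) by apply: openI => //; exact: closed_openC.
have [h hW Lh] := inner_adherent (V `&` ~` C) e0.
have fhV : below V (f + h - e *: 1).
  move=> alpha Ka; have [f1 f0] := fVU _ Ka; have [h1 h0] := hW _ Ka.
  have -> : (alpha (f + h - e *: 1) : R) = alpha f + alpha h - e.
    by rewrite eval_sub_cst//; have [[k ->] _] := Ka; rewrite rmorphD.
  split.
    have [fe|fe] := ltP (alpha f : R) e; first by lra.
    have : (alpha h : R) <= 0 by apply: h0 => -[_]; apply; split.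
    lra.
  move=> nV; have : (alpha f : R) <= 0 by apply: f0 => -[].
  have : (alpha h : R) <= 0 by apply: h0 => -[].
  lra.
have := below_inner fhV.
rewrite linearB linearD linearZ /= L1 mulr1 => LV.
apply: (@le_trans _ _ ((L f + e)%:E + (L h + e)%:E)%E).
  apply: leeD.
    by apply: le_trans Lf; apply: outer_le_inner; [exact: openI|exact: setSI].
  apply: le_trans Lh; apply: outer_le_inner => // alpha [Xa nU].
  split; first exact: XV.
  move=> [Ka /= ef]; have [_ f0] := fVU _ Ka.
  by have : (alpha f : R) <= 0 by [apply: f0 => -[]]; lra.
have -> : ((L f + e)%:E + (L h + e)%:E = (L f + L h - e)%:E + e'%:E :> \bar R)%E.
  rewrite -!EFinD eE; move: (L f) (L h) e {e0 eE Lf Lh C cC oW hW fhV LV} => x y z.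
  by congr (_%:E); ring.
by rewrite leeD2r.
Qed.

End riesz.

(** * The representing measure *)

Lemma borel_open (T : ptopologicalType) (U : set T) :
  open U -> measurable (U : set (borelType T)).
Proof. exact: sub_sigma_algebra. Qed.

Lemma borel_closed (T : ptopologicalType) (C : set T) :
  closed C -> measurable (C : set (borelType T)).
Proof.
by move=> cC; rewrite -(setCK C); apply: measurableC; apply: borel_open;
   exact: closed_openC.
Qed.

Lemma borel_continuous (R : realType) (T : ptopologicalType) (f : T -> R)
    (D : set (borelType T)) :
  continuous f -> measurable_fun D (f : borelType T -> R).
Proof.
move=> /continuousP cf; apply: (measurable_funS measurableT) => //.
apply: (measurability _ (RGenOpens.measurableE R)).
move=> _ [_ [x [y ->] <-]]; rewrite setTI; apply: borel_open.
exact/cf/interval_open.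
Qed.

(** The sum counts the integers from 1 to [N] that do not exceed [y], so it is the integer part of
    [y]. *)
Lemma layer_cake (R : realType) (y : R) N : 0 <= y <= N%:R ->
  \sum_(k < N) ((k.+1%:R <= y)%R : nat)%:R <= y <=
    1 + \sum_(k < N) ((k.+1%:R <= y)%R : nat)%:R.
Proof.
elim: N y => [|N ih] y /andP[y0 yN].
  by rewrite big_ord0; apply/andP; split; lra.
have [y1|y1] := leP 1 y; last first.
  rewrite big1 => [|i _]; first by apply/andP; split; lra.
  by rewrite leNgt (lt_le_trans y1)// ler1n.
have /ih : 0 <= y - 1 <= N%:R by rewrite -natr1 in yN; apply/andP; split; lra.
have -> : \sum_(k < N.+1) ((k.+1%:R <= y)%R : nat)%:R =
    1 + \sum_(k < N) ((k.+1%:R <= y - 1)%R : nat)%:R :> R.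
  rewrite big_ord_recl /= y1; congr (_ + _); apply: eq_bigr => i _.
  by rewrite lerBrDr natr1.
by move=> /andP[? ?]; apply/andP; split; lra.
Qed.

Lemma unit_mass_setC d (X : measurableType d) (R : realType)
    (mu : {measure set X -> \bar R}) B :
  mu setT = 1%E -> measurable B -> (mu B + mu (~` B) = 1)%E.
Proof.
move=> mu1 mB; rewrite -mu1 -(setUv B) measureU//; first exact: measurableC.
exact: setICr.
Qed.

Section character_integrals.
Variables (R : realType) (A : comAlgType R) (b : A -> R).
Notation T := {ptws A -> R}.
Notation K := (bounded_characters b).
Variable nu : {measure set (borelType T) -> \bar R}.

Lemma bounded_characters_measurable : measurable (K : set (borelType T)).
Proof. by apply: borel_closed; exact: bounded_characters_closed. Qed.

Lemma eval_measurable (D : set (borelType T)) (a : A) :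
  measurable_fun D (fun alpha : borelType T => alpha a : R).
Proof.
apply: (@borel_continuous R T (fun alpha : T => alpha a : R)).
exact: ptws_eval_continuous.
Qed.

Hypothesis nu_fin : (nu K < +oo)%E.

Lemma eval_integrable a :
  nu.-integrable K (EFin \o (fun alpha : borelType T => alpha a : R)).
Proof.
apply: measurable_bounded_integrable => //.
- exact: bounded_characters_measurable.
- exact: eval_measurable.
exists (b a); split; first exact: num_real.
by move=> x bx alpha [_ Ka]; apply: le_trans (Ka a) _; exact: ltW.
Qed.

Lemma integral_eval_lin k (x y : A) :
  (\int[nu]_(alpha in K) (alpha (k *: x + y))%:E =
   k%:E * \int[nu]_(alpha in K) (alpha x)%:E +
   \int[nu]_(alpha in K) (alpha y)%:E)%E.
Proof.
transitivity (\int[nu]_(alpha in K) (k%:E * (alpha x : R)%:E + (alpha y : R)%:E))%E.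
  apply: eq_integral => alpha; rewrite inE => -[/charactersP[_ _ h] _].
  by rewrite h EFinD EFinM.
rewrite integralD//; last 3 first.
- exact: bounded_characters_measurable.
- apply: integrableZl; first exact: bounded_characters_measurable.
  exact: eval_integrable.
- exact: eval_integrable.
rewrite integralZl//; first exact: bounded_characters_measurable.
exact: eval_integrable.
Qed.

Lemma integral_eval_cst k :
  (\int[nu]_(alpha in K) (alpha (k *: 1))%:E = k%:E * nu K)%E.
Proof.
rewrite -integral_cst; last exact: bounded_characters_measurable.
apply: eq_integral => alpha; rewrite inE => -[[f ->] _].
by rewrite linearZ /= rmorph1 mulr1.
Qed.

Lemma integral_eval1 : (\int[nu]_(alpha in K) (alpha 1)%:E = nu K)%E.
Proof. by rewrite -[RHS]mul1e -integral_eval_cst scale1r. Qed.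

Lemma integral_eval_fin_num a :
  (\int[nu]_(alpha in K) (alpha a)%:E)%E \is a fin_num.
Proof.
apply: integrable_fin_num; last exact: eval_integrable.
exact: bounded_characters_measurable.
Qed.

End character_integrals.

Lemma representing_measure_mass (R : realType) (A : comAlgType R) (b : A -> R)
    (L : A -> R) (nu : {measure set (borelType {ptws A -> R}) -> \bar R}) :
  L 1 = 1 -> nu (~` bounded_characters b) = 0%E ->
  (forall a, (L a)%:E = (\int[nu]_(alpha in bounded_characters b) (alpha a)%:E)%E) ->
  nu setT = 1%E.
Proof.
move=> L1 nuK0 nurep.
have nuK : nu (bounded_characters b) = 1%E by rewrite -integral_eval1 -nurep L1.
rewrite -(setUv (bounded_characters b)) measureU ?setICr//; last 2 first.
- exact: bounded_characters_measurable.
- by apply: measurableC; exact: bounded_characters_measurable.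
by rewrite [X in (_ + X)%E]nuK0 adde0.
Qed.

Section riesz_measure.
Variables (R : realType) (A : comAlgType R) (b : A -> R).
Hypothesis b_gt0 : forall a, 0 < b a.
Notation K := (bounded_characters b).
Notation T := {ptws A -> R}.
Variable L : {scalar A}.
Hypothesis L1 : L 1 = 1.
Hypothesis L_ge0 : forall a,
  (forall alpha : T, K alpha -> 0 <= (alpha a : R)) -> 0 <= L a.

Lemma exists_riesz_measure :
  exists mu : {measure set (borelType T) -> \bar R},
    forall B, mu B = outer b L B.
Proof.
exact: (@caratheodory_borel_measure _ _ (outer_measure_of b_gt0 L1 L_ge0)
  (open_caratheodory b_gt0 L1 L_ge0)).
Qed.

Variable mu : {measure set (borelType T) -> \bar R}.
Hypothesis muE : forall B, mu B = outer b L B.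

Lemma riesz_open U : open U -> mu U = inner b L U.
Proof. by move=> oU; rewrite muE outer_open. Qed.

Lemma riesz_setT : mu setT = 1%E.
Proof. by rewrite riesz_open ?innerT//; exact: openT. Qed.

Lemma riesz_setCK : mu (~` K) = 0%E.
Proof.
rewrite riesz_open; last by apply: closed_openC; exact: bounded_characters_closed.
apply/eqP; rewrite eq_le inner_ge0 andbT; apply: inner_le => a a0.
rewrite lee_fin -(linear0 L); apply: (functional_le L_ge0) => alpha Ka.
have [_ h] := a0 _ Ka; have := h (fun f => f Ka).
by have [[f ->] _] := Ka; rewrite rmorph0.
Qed.

Lemma riesz_K : mu K = 1%E.
Proof.
have := unit_mass_setC riesz_setT (bounded_characters_measurable b).
by rewrite riesz_setCK adde0.
Qed.

Lemma riesz_fin_num B : measurable B -> mu B \is a fin_num.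
Proof.
move=> mB; rewrite ge0_fin_numE// (@le_lt_trans _ _ 1%E) ?ltry//.
by rewrite -riesz_setT le_measure// inE.
Qed.

(** Take [1 - h] with [h] almost optimal below the complement of [C], and use that the total mass is
    1. *)
Lemma riesz_majorant (C : set T) (e : R) : closed C -> 0 < e -> exists f : A,
  [/\ forall alpha : T, K alpha -> 0 <= (alpha f : R),
      forall alpha : T, K alpha -> C alpha -> 1 <= (alpha f : R) &
      ((L f)%:E <= mu C + e%:E)%E].
Proof.
move=> cC e0; have mC := borel_closed cC.
have [h hC Lh] := inner_adherent L1 L_ge0 (~` C) e0.
have fE (alpha : T) : K alpha -> (alpha (1 - h) : R) = 1 - alpha h.
  by move=> [[f ->] _]; rewrite rmorphB rmorph1.
exists (1 - h); split=> [alpha Ka|alpha Ka Ca|].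
- by rewrite fE// subr_ge0; have [] := hC _ Ka.
- by rewrite fE// lerBrDr gerDl; have [_ h0] := hC _ Ka; apply: h0; apply.
have := unit_mass_setC riesz_setT mC.
rewrite (@riesz_open (~` C)); last exact: closed_openC.
rewrite -(fineK (riesz_fin_num mC)).
move: Lh; rewrite -(fineK (inner_fin_num L1 L_ge0 (~` C))) -!EFinD !lee_fin => Lh [mCE].
by rewrite linearB L1; lra.
Qed.

(** Inner regularity at [B] is outer regularity at its complement: if the open set [U] is a tight
    cover of the complement, [K] minus [U] is a compact part of [B] with almost the same mass. *)
Lemma riesz_radon : radon_on K mu.
Proof.
split; first exact: riesz_setCK.
  move=> x _; exists setT; split=> //; first exact: openT.
  by rewrite riesz_setT ltry.
move=> B mB; apply/eqP; rewrite eq_le; apply/andP; split; last first.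
  apply: ge_ereal_sup => _ [C [cC CKB] <-]; apply: le_measure; rewrite ?inE//.
    by apply: borel_closed; apply: compact_closed => //; exact: ptws_hausdorff.
  by move=> x /CKB[].
apply/lee_addgt0Pr => e e0.
have [U [oU BU]] := outer_adherent L1 L_ge0 (~` B) e0.
rewrite -riesz_open// -muE => Ue.
have mU := borel_open oU.
pose C := K `&` ~` U.
have cC : compact C.
  apply: compact_closedI; first exact: bounded_characters_compact.
  exact: open_closedC.
have mC : measurable (C : set (borelType T)).
  by apply: borel_closed; apply: compact_closed => //; exact: ptws_hausdorff.
apply: (@le_trans _ _ (mu C + e%:E)%E); last first.
  rewrite leeD2r//; apply: ereal_sup_ubound; exists C => //; split=> //.
  move=> x [Kx nU]; split=> //; apply: contrapT => nB.
  by apply: nU; exact: BU.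
have CUE : (mu (K `&` ~` U) + mu U = 1)%E.
  have := unit_mass_setC riesz_setT mC; rewrite /C setCI setCK => <-.
  congr (_ + _)%E; apply/eqP; rewrite eq_le; apply/andP; split.
    apply: le_measure; [by rewrite inE|rewrite inE|by move=> x; right].
    apply: measurableU => //; apply: measurableC; exact: bounded_characters_measurable.
  apply: le_trans (measureU2 _ _ _) _ => //.
    by apply: measurableC; exact: bounded_characters_measurable.
  by rewrite [X in (X + _)%E]riesz_setCK add0e.
have := unit_mass_setC riesz_setT mB; move: Ue; rewrite -CUE -/C.
rewrite -(fineK (riesz_fin_num mC)) -(fineK (riesz_fin_num mU)).
rewrite -(fineK (riesz_fin_num mB)) -(fineK (riesz_fin_num (measurableC mB))).
rewrite -!EFinD !lee_fin => ? [?]; lra.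
Qed.

(** Cut [a] at the levels [k.+1 / N] and majorize each superlevel set [C k] by some [f k]. The
    layer-cake bounds give [N * L a <= 1 + \sum_k L (f k)] and [\sum_k mu (C k) <= N * \int a]; the
    errors, divided by [N], are [1 / N] and [e]. *)
Lemma riesz_le_integral a : unit_valued b a ->
  ((L a)%:E <= \int[mu]_(alpha in K) (alpha a)%:E)%E.
Proof.
move=> a01.
have mu_fin : (mu K < +oo)%E by rewrite riesz_K ltry.
have If := integral_eval_fin_num mu_fin a.
apply/lee_addgt0Pr => e' e'0; pose e : R := e' / 2.
have e0 : 0 < e by rewrite divr_gt0.
have [n ne] := exists_natmul_ge e^-1 (ltr01 : 0 < 1 :> R).
pose N := n.+1; have N0 : 0 < N%:R :> R by rewrite ltr0n.
have Ne : 1 <= N%:R * e.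
  by rewrite -ler_pdivrMr// mul1r (le_trans ne)// /N -natr1 addrC.
pose C (k : nat) := K `&` [set alpha : T | k.+1%:R / N%:R <= (alpha a : R)].
have cC k : closed (C k).
  apply: compact_closed; [exact: ptws_hausdorff|exact: superlevel_compact].
have mC k := borel_closed (cC k).
have /choice [f fP] := fun k => riesz_majorant (cC k) e0.
have CE (alpha : T) (k : nat) : K alpha ->
    \1_(C k) alpha = ((k.+1%:R <= N%:R * (alpha a : R))%R : nat)%:R :> R.
  move=> Ka; rewrite indicE; congr ((nat_of_bool _)%:R).
  rewrite mulrC -ler_pdivrMr//; apply/idP/idP => [/set_mem[]//|h].
  by apply/mem_set; split.
have Na (alpha : T) : K alpha -> 0 <= N%:R * (alpha a : R) <= N%:R.
  move=> /a01 /andP[? ?]; apply/andP; split; first by rewrite mulr_ge0// ltW.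
  by rewrite -[leRHS]mulr1 ler_pM2l.
have muC k : mu (C k) = (\int[mu]_(alpha in K) (\1_(C k) alpha)%:E)%E.
  rewrite integral_indic//; last exact: bounded_characters_measurable.
  by congr (mu _); apply/esym/setIidl => ? [].
have sumC : \sum_(k < N) fine (mu (C k)) <=
    N%:R * fine (\int[mu]_(alpha in K) (alpha a)%:E)%E.
  rewrite -lee_fin EFinM fineK// -sumEFin.
  rewrite (eq_bigr (fun k : 'I_N => \int[mu]_(alpha in K) (\1_(C k) alpha)%:E)%E); last first.
    by move=> k _; rewrite fineK ?muC// -muC riesz_fin_num.
  rewrite -ge0_integral_sum; last 3 first.
  - exact: bounded_characters_measurable.
  - by move=> k; apply/measurable_EFinP; exact: measurable_indic.
  - by move=> k alpha _; rewrite lee_fin.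
  rewrite -integralZl; last 2 first.
  - exact: bounded_characters_measurable.
  - exact: eval_integrable.
  apply: ge0_le_integral.
  - exact: bounded_characters_measurable.
  - by move=> alpha _; apply: sume_ge0 => k _; rewrite lee_fin.
  - by apply: emeasurable_sum => k; apply/measurable_EFinP; exact: measurable_indic.
  - by apply/measurable_EFinP; apply: measurable_funM => //; exact: eval_measurable.
  move=> alpha Ka; rewrite sumEFin -EFinM lee_fin.
  under eq_bigr do rewrite CE//.
  by have /andP[] := layer_cake (Na _ Ka).
have aE : N%:R * L a <= 1 + \sum_(k < N) L (f k).
  rewrite -linear_sum mulr_natl -linearMn -[X in _ <= X + _]L1 -linearD.
  apply: (functional_le L_ge0) => alpha Ka; have [[g gE] _] := Ka.
  have -> : alpha (a *+ N) = N%:R * (alpha a : R) by rewrite gE rmorphMn /= mulr_natl.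
  have /andP[_ /le_trans] := layer_cake (Na _ Ka); apply.
  have -> : (alpha (1 + \sum_(k < N) f k) : R) = 1 + \sum_(k < N) (alpha (f k) : R).
    by rewrite gE rmorphD rmorph1 rmorph_sum.
  rewrite lerD2l; apply: ler_sum => k _.
  have [f0 f1 _] := fP k; rewrite -CE// indicE.
  have [/set_mem Ck|_] := boolP (alpha \in C k); last exact: f0.
  exact: f1.
have sumf : \sum_(k < N) L (f k) <= \sum_(k < N) fine (mu (C k)) + N%:R * e.
  rewrite (_ : N%:R * e = \sum_(k < N) e); last first.
    by rewrite sumr_const card_ord mulr_natl.
  rewrite -big_split /=; apply: ler_sum => k _; have [_ _] := fP k.
  by rewrite -(fineK (riesz_fin_num (mC k))) -EFinD lee_fin.
rewrite -(fineK If) -EFinD lee_fin -(ler_pM2l N0) mulrDr.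
by rewrite (_ : e' = e + e) ?mulrDr; [lra|rewrite /e; field].
Qed.

Lemma riesz_represents a :
  (L a)%:E = (\int[mu]_(alpha in K) (alpha a)%:E)%E.
Proof.
have mu_fin : (mu K < +oo)%E by rewrite riesz_K ltry.
have unitE u : unit_valued b u -> (L u)%:E = (\int[mu]_(alpha in K) (alpha u)%:E)%E.
  move=> u01; apply/eqP; rewrite eq_le riesz_le_integral//=.
  (* This is [1 - u] in the shape that [integral_eval_lin] and [integral_eval_cst] expect. *)
  have v01 : unit_valued b (- 1 *: u + 1 *: 1).
    move=> alpha Ka; have /andP[? ?] := u01 _ Ka; have [[g gE] _] := Ka.
    rewrite gE linearD !linearZ /= rmorph1 -gE.
    by apply/andP; split; lra.
  have := riesz_le_integral v01; rewrite integral_eval_lin// integral_eval_cst//.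
  rewrite riesz_K mule1 linearD !linearZ /= L1 -(fineK (integral_eval_fin_num mu_fin u)).
  by rewrite -EFinM -EFinD !lee_fin; lra.
have ba := b_gt0 a.
(* On [K] the values of [a] lie between [- b a] and [b a]; this affine change maps them into
   [0, 1]. *)
pose u := (2 * b a)^-1 *: a + 2^-1 *: 1.
have u01 : unit_valued b u.
  move=> alpha Ka; have [[g gE] /(_ a)] := Ka.
  rewrite gE linearD !linearZ /= rmorph1 -gE mulr1 ler_norml => /andP[? ?].
  have d0 : 0 < (2 * b a)^-1 by rewrite invr_gt0 mulr_gt0.
  have dE : (2 * b a)^-1 * b a = 2^-1 by field; rewrite gt_eqF.
  by apply/andP; split; nra.
have aE : a = (2 * b a) *: u + (- b a) *: 1.
  rewrite /u scalerDr !scalerA divff ?gt_eqF ?mulr_gt0// scale1r.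
  have -> : 2 * b a / 2 = b a by field.
  by rewrite -addrA -scalerDl subrr scale0r addr0.
rewrite [in RHS]aE integral_eval_lin// integral_eval_cst// riesz_K mule1.
by rewrite -unitE// -EFinM -EFinD [in LHS]aE linearD !linearZ /= L1 mulr1.
Qed.

(** Inner regularity of [nu] reduces [nu B <= mu B] to compact sets, where a majorant [f] gives
    [nu C <= \int f = L f <= mu C + e]. Both total masses are 1, so the inequality for the
    complement is the reverse one. *)
Lemma riesz_unique (nu : {measure set (borelType T) -> \bar R}) :
  radon_on K nu ->
  (forall a, (L a)%:E = (\int[nu]_(alpha in K) (alpha a)%:E)%E) ->
  forall B, measurable B -> nu B = mu B.
Proof.
move=> [nuK0 _ nur] nurep.
have nuT := representing_measure_mass L1 nuK0 nurep.
have le B : measurable B -> (nu B <= mu B)%E.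
  move=> mB; rewrite nur//; apply: ge_ereal_sup => _ [C [cC CKB] <-].
  have clC : closed C by apply: compact_closed => //; exact: ptws_hausdorff.
  have mC := borel_closed clC.
  apply: (@le_trans _ _ (mu C)); last first.
    by apply: le_measure; rewrite ?inE// => x /CKB[].
  apply/lee_addgt0Pr => e e0; have [f [f0 f1 fe]] := riesz_majorant clC e0.
  apply: le_trans fe; rewrite nurep.
  have -> : nu C = (\int[nu]_(alpha in K) (\1_C alpha)%:E)%E.
    rewrite integral_indic//; last exact: bounded_characters_measurable.
    by congr (nu _); apply/esym/setIidl => ? /CKB[].
  apply: ge0_le_integral.
  - exact: bounded_characters_measurable.
  - by move=> alpha _; rewrite lee_fin.
  - by apply/measurable_EFinP; exact: measurable_indic.
  - by apply/measurable_EFinP; exact: eval_measurable.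
  move=> alpha Ka; rewrite lee_fin indicE.
  have [/set_mem Ca|_] := boolP (alpha \in C); [exact: f1|exact: f0].
move=> B mB; apply/eqP; rewrite eq_le le//=.
have nufin X : measurable X -> nu X \is a fin_num.
  move=> mX; rewrite ge0_fin_numE// (@le_lt_trans _ _ 1%E) ?ltry//.
  by rewrite -nuT le_measure// inE.
have := le _ (measurableC mB).
have := unit_mass_setC riesz_setT mB; have := unit_mass_setC nuT mB.
rewrite -(fineK (riesz_fin_num mB)) -(fineK (riesz_fin_num (measurableC mB))).
rewrite -(fineK (nufin _ mB)) -(fineK (nufin _ (measurableC mB))).
by rewrite -!EFinD !lee_fin => -[?] [?]; lra.
Qed.

End riesz_measure.

(** * Moment conditions *)

Section moment_conditions.
Variables (R : realType) (A : comAlgType R) (b : A -> R).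
Hypothesis b_gt0 : forall a, 0 < b a.
Variable L : {scalar A}.
Hypothesis L1 : L 1 = 1.
Notation T := {ptws A -> R}.
Notation K := (bounded_characters b).
Notation I a := (`[- b a, b a]%classic : set R).

Definition ratio_condition := forall a : A,
  (ereal_sup [set (L (a ^+ (2 * n + 2)) / L (a ^+ (2 * n)))%R%:E
             | n in [set n : nat | (L (a ^+ (2 * n)) <> 0)%R]]
   <= (b a ^+ 2)%:E)%E.

Lemma ratio_conditionP : psd L -> ratio_condition <->
  forall a n, L (a ^+ (2 * n + 2)) <= b a ^+ 2 * L (a ^+ (2 * n)).
Proof.
move=> pL; have L0 a n : 0 <= L (a ^+ (2 * n)) by rewrite mulnC exprM.
split=> [rL a n|rL a].
  have [Ln|/eqP Ln] := eqVneq (L (a ^+ (2 * n))) 0; last first.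
    rewrite -ler_pdivrMr; last by rewrite lt_neqAle eq_sym L0 andbT; exact/eqP.
    rewrite -lee_fin; apply: le_trans (rL a); apply: ereal_sup_ubound.
    by exists n.
  (* At an index excluded from the supremum, Cauchy-Schwarz forces the next even moment to vanish as
     well. *)
  have := psd_cauchy_schwarz (a ^+ n) (a ^+ n.+2) pL.
  rewrite -exprD -!exprM [(n * 2)%N]mulnC Ln mul0r mulr0 addnS addnS addnn -mul2n.
  by rewrite addn2; have := sqr_ge0 (L (a ^+ (2 * n).+2)); nra.
apply: ge_ereal_sup => _ [n /eqP Ln <-]; rewrite lee_fin ler_pdivrMr//.
by rewrite lt_neqAle eq_sym Ln L0.
Qed.

(** Even powers are nonnegative, and on the interval [x ^+ (2 * n + 2)] is at most
    [b a ^+ 2 * x ^+ (2 * n)]; both facts are integrated. *)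
Lemma moment_measures_psd :
  (forall a : A, exists mu : {measure set (borelType R) -> \bar R},
     forall n : nat,
       (L (a ^+ n))%:E = (\int[mu]_(x in I a) (x ^+ n)%R%:E)%E) ->
  psd L /\ forall a n, L (a ^+ (2 * n + 2)) <= b a ^+ 2 * L (a ^+ (2 * n)).
Proof.
move=> H; split=> a => [|n].
  have [mu muL] := H a; rewrite -lee_fin muL; apply: integral_ge0 => x _.
  by rewrite lee_fin sqr_ge0.
have [mu muL] := H a; rewrite -lee_fin EFinM !muL.
have ev0 (x : R) : (0 <= (x ^+ (2 * n))%:E)%E.
  by rewrite lee_fin mulnC exprM sqr_ge0.
have mI : measurable (I a : set (borelType R)).
  by apply: borel_closed; exact: interval_closed.
have mX m : measurable_fun (I a : set (borelType R))
    (fun x : borelType R => (x ^+ m)%:E : \bar R).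
  by apply/measurable_EFinP; apply: borel_continuous; exact: exprn_continuous.
rewrite -ge0_integralZl_EFin//; last by rewrite sqr_ge0.
apply: ge0_le_integral => //.
- by move=> x _; rewrite lee_fin -(mulnDr 2 n 1) mulnC exprM sqr_ge0.
- have -> : (fun x : borelType R => (b a ^+ 2)%:E * (x ^+ (2 * n))%:E)%E =
      EFin \o (fun x : borelType R => b a ^+ 2 * x ^+ (2 * n)).
    by apply/funext => x; rewrite /= EFinM.
  apply/measurable_EFinP; apply: measurable_funM => //.
  by apply: borel_continuous; exact: exprn_continuous.
move=> x /=; rewrite in_itv /= -ler_norml => xb.
rewrite -EFinM lee_fin exprD mulrC; apply: ler_wpM2r; first by rewrite -lee_fin.
by rewrite -[x ^+ 2]real_normK ?num_real// lerXn2r// nnegrE ltW.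
Qed.

Lemma moment_growth :
  (forall a n, L (a ^+ (2 * n + 2)) <= b a ^+ 2 * L (a ^+ (2 * n))) ->
  forall a n, L (a ^+ (2 * n)) <= b a ^+ (2 * n).
Proof.
move=> rL a; elim=> [|n ih]; first by rewrite !expr0 L1.
rewrite mulnS addnC; apply: le_trans (rL a n) _.
by rewrite exprD mulrC; apply: ler_wpM2r => //; exact: sqr_ge0.
Qed.

Lemma exists_unique_character_measure : psd L ->
  (forall a n, L (a ^+ (2 * n)) <= b a ^+ (2 * n)) ->
  exists mu : {measure set (borelType T) -> \bar R},
    [/\ radon_on K mu,
      forall a : A, (L a)%:E = (\int[mu]_(alpha in K) (alpha a)%:E)%E
      & forall nu : {measure set (borelType T) -> \bar R},
          radon_on K nu ->
          (forall a : A, (L a)%:E = (\int[nu]_(alpha in K) (alpha a)%:E)%E) ->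
          forall B, measurable B -> nu B = mu B].
Proof.
move=> pL Lb; have L_ge0 a := @states_ge0 _ _ _ b_gt0 L a pL L1 Lb.
have [mu muE] := exists_riesz_measure b_gt0 L1 L_ge0.
exists mu; split.
- exact: (riesz_radon L1 L_ge0 muE).
- exact: (riesz_represents b_gt0 L1 L_ge0 muE).
- exact: (riesz_unique L1 L_ge0 muE).
Qed.

Lemma character_measure_moments (mu : {measure set (borelType T) -> \bar R}) :
  radon_on K mu ->
  (forall a : A, (L a)%:E = (\int[mu]_(alpha in K) (alpha a)%:E)%E) ->
  forall a : A, exists nu : {measure set (borelType R) -> \bar R},
    radon_on (I a) nu /\
    forall n : nat,
      (L (a ^+ n))%:E = (\int[nu]_(x in I a) (x ^+ n)%R%:E)%E.
Proof.
move=> [muK0 _ mur] murep a.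
have mKc : measurable (~` K : set (borelType T)).
  by apply: measurableC; exact: bounded_characters_measurable.
have mu1 := representing_measure_mass L1 muK0 murep.
pose ev : borelType T -> borelType R := fun alpha => (alpha : T) a.
have cev : continuous (ev : T -> R) by exact: ptws_eval_continuous.
have mev : measurable_fun setT ev.
  apply: (@measurability _ _ (borelType T) (borelType R) setT ev (@open R) erefl).
  move=> _ [U oU <-]; rewrite setTI; apply: borel_open.
  by move/continuousP : cev; exact.
have mpre (B : set (borelType R)) : measurable B -> measurable (ev @^-1` B).
  by move=> mB; rewrite -[X in measurable X]setTI; exact: mev.
pose m := measure_function_pushforward__canonical__measure_function_Measure mu mev.
exists m.
have mE B : m B = mu (ev @^-1` B) by [].
have KI : K `<=` ev @^-1` I a.
  by move=> alpha [_ /(_ a)]; rewrite ler_norml /= in_itv.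
have mI : measurable (I a : set (borelType R)).
  by apply: borel_closed; exact: interval_closed.
have muN (N : set (borelType T)) : measurable N -> N `<=` ~` K -> mu N = 0%E.
  by move=> mN NK; apply: (subset_measure0 mN mKc NK muK0).
split.
  split.
  - rewrite mE; apply: muN; first by apply: mpre; exact: measurableC.
    by move=> alpha nI /KI.
  - move=> x _; exists setT; split => //; first exact: openT.
    by rewrite mE preimage_setT mu1 ltry.
  move=> B mB; rewrite mE mur; last exact: mpre.
  (* For one inequality a compact part of the preimage is replaced by its compact image; the other
     is monotonicity of [mu] on preimages. *)
  apply/eqP; rewrite eq_le; apply/andP; split.
    apply: ge_ereal_sup => _ [C [cC CKB] <-].
    have cevC : compact (ev @` C).
      by apply: continuous_compact => //; apply: continuous_subspaceT.
    have mevC : measurable (ev @` C : set (borelType R)).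
      apply: borel_closed; apply: compact_closed => //; exact: Rhausdorff.
    apply: (@le_trans _ _ (m (ev @` C))).
      rewrite mE; apply: le_measure; rewrite ?inE//.
      - apply: borel_closed; apply: compact_closed => //; exact: ptws_hausdorff.
      - exact: mpre.
      - by move=> alpha Ca; exists alpha.
    apply: ereal_sup_ubound; exists (ev @` C) => //; split=> //.
    by move=> _ [alpha /CKB[Ka Ba] <-]; split=> //; exact: KI.
  apply: ge_ereal_sup => _ [D [cD DIB] <-]; rewrite -mur; last exact: mpre.
  have mD : measurable (D : set (borelType R)).
    apply: borel_closed; apply: compact_closed => //; exact: Rhausdorff.
  rewrite mE; apply: le_measure; rewrite ?inE//; try exact: mpre.
  by move=> alpha /DIB[].
move=> n.
have mX D : measurable_fun D (fun x : borelType R => x ^+ n : R).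
  by apply: borel_continuous; exact: exprn_continuous.
have intI : mu.-integrable (ev @^-1` I a) ((fun x : borelType R => (x ^+ n)%:E) \o ev).
  apply: (@measurable_bounded_integrable _ _ _ mu (fun alpha => (ev alpha : R) ^+ n)).
  - exact: mpre.
  - apply: (@le_lt_trans _ _ 1%E); last exact: ltry.
    by rewrite -mu1; apply: le_measure; rewrite ?inE//; exact: mpre.
  - apply: (measurable_funS measurableT) => //.
    exact: (measurableT_comp (mX setT) mev).
  exists (b a ^+ n); split; first exact: num_real.
  move=> x bx alpha; rewrite /= in_itv /= -ler_norml => ab.
  rewrite normrX; apply: le_trans (ltW bx); apply: lerXn2r => //.
  by rewrite nnegrE ltW.
rewrite integral_pushforward//; last by apply/measurable_EFinP; exact: mX.
(* The change of variables gives an integral over the whole preimage of the interval, which exceeds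
   [K] by a null set only. *)
have KE : K = ev @^-1` I a `\` (ev @^-1` I a `&` ~` K).
  apply/seteqP; split=> alpha.
    by move=> Ka; split; [exact: KI|move=> [_]].
  by move=> [Ia h]; apply: contrapT => nK; apply: h.
rewrite (@negligible_integral _ _ _ _ _ (ev @^-1` I a `&` ~` K)) //; last 3 first.
- by apply: measurableI => //; exact: mpre.
- exact: mpre.
- by apply: muN => [|? []//]; apply: measurableI => //; exact: mpre.
rewrite -KE murep; apply: eq_integral => alpha; rewrite inE => -[[f fE] _].
by rewrite /ev /= fE rmorphXn.
Qed.

End moment_conditions.

Theorem theorem5p1 (R : realType) (A : comAlgType R)
    (XA : characters A !=set0)
    (b : A -> R) (b_gt0 : forall a, 0 < b a)
    (L : {scalar A}) (L1 : L 1 = 1) :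
  let I (a : A) : set R := `[- b a, b a]%classic in
  let K : set {ptws A -> R} := bounded_characters b in
  let represents (nu : {measure set (borelType {ptws A -> R}) -> \bar R}) :=
    forall a : A, (L a)%:E = (\int[nu]_(alpha in K) (alpha a)%:E)%E in
  [<-> forall a : A,
         exists mu : {measure set (borelType R) -> \bar R},
           radon_on (I a) mu /\
           forall n : nat, (L (a ^+ n))%:E = (\int[mu]_(x in I a) (x ^+ n)%R%:E)%E;
       psd L /\
       forall a : A,
         (ereal_sup [set (L (a ^+ (2 * n + 2)) / L (a ^+ (2 * n)))%R%:E
                    | n in [set n : nat | (L (a ^+ (2 * n)) <> 0)%R]]
          <= (b a ^+ 2)%:E)%E;
       exists mu : {measure set (borelType {ptws A -> R}) -> \bar R},
         [/\ radon_on K mu, represents mu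
           & forall nu : {measure set (borelType {ptws A -> R}) -> \bar R},
               radon_on K nu -> represents nu ->
               forall B, measurable B -> nu B = mu B]].
Proof.
move=> I K represents; tfae.
- move=> H; have [|pL rL] := @moment_measures_psd R A b b_gt0 L.
    by move=> a; have [mu [_ muL]] := H a; exists mu.
  by split=> //; exact/ratio_conditionP.
- move=> [pL /(ratio_conditionP _ pL) rL].
  by apply: exists_unique_character_measure => //; exact: moment_growth.
- by move=> [mu [muK murep _]]; exact: (character_measure_moments b_gt0 L1 muK murep).
Qed.
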